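(* Let $d\ge 3$ and $k\ge 0$ be integers. Suppose $T\in\mathscr{S}_k^d$ and $\operatorname{Vol}(T)=\frac{1}{d!}(dk+1)$. Then the points of $\operatorname{int}(T)\cap\mathbb{Z}^d$ are collinear with some vertex of $T$; that is, there exist a vertex $v$ of $T$ and a line in $\mathbb{R}^d$ containing $(\operatorname{int}(T)\cap\mathbb{Z}^d)\cup\{v\}$.
   Context: $\operatorname{Vol}$ is $d$-dimensional Lebesgue volume and $\operatorname{int}$ denotes interior. A lattice $d$-simplex is a nondegenerate ($d$-dimensional) simplex in $\mathbb{R}^d$ all of whose $d+1$ vertices lie in $\mathbb{Z}^d$. A lattice polytope $P$ is clean if the only points of $\mathbb{Z}^d$ on its boundary are its vertices. $\mathscr{S}_k^d$ is the collection of clean lattice $d$-simplices in $\mathbb{R}^d$ with exactly $k$ points of $\mathbb{Z}^d$ in their interior. *)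

(* Defs.v *)
From HB Require Import structures.
From mathcomp Require Import all_boot all_order all_algebra.
From mathcomp Require Import all_classical all_reals all_analysis.
Import Order.TTheory GRing.Theory Num.Theory.
Import numFieldNormedType.Exports.

Set Implicit Arguments.
Unset Strict Implicit.
Unset Printing Implicit Defensive.

Local Open Scope classical_set_scope.
Local Open Scope ring_scope.

Section LebesgueVolume.
Context (R : realType).

(* The d-fold product of the Lebesgue measure on the real line, defined by
   R^(n+1) = R x R^n; the measure on R^0 is the unit mass at its only point. *)
Fixpoint lebesgue_tuple (n : nat) :
    set (n.-tuple (measurableTypeR R)) -> \bar R :=
  match n with
  | 0 => \d_[tuple]
  | m.+1 => pushforward (@lebesgue_measure R \x @lebesgue_tuple m)%E
              (fun p : measurableTypeR R * m.-tuple (measurableTypeR R) =>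
                 [tuple of p.1 :: p.2])
  end.

Definition Vol (d : nat) (A : set 'rV[R]_d) : \bar R :=
  lebesgue_tuple [set t : d.-tuple (measurableTypeR R) | A (\row_i tnth t i)].

End LebesgueVolume.

Section LatticeSimplices.
Context (R : realType) (d : nat).
Implicit Types (A P T : set 'rV[R]_d) (v : 'I_d.+1 -> 'rV[R]_d).

Definition lattice : set 'rV[R]_d := [set x | forall j, x ord0 j \is a Num.int].

Definition convex_hull A : set 'rV[R]_d :=
  smallest (@convex_set R 'rV[R]_d) A.

Definition affinely_independent v : Prop :=
  forall w : 'I_d.+1 -> R,
    \sum_i w i = 0 -> \sum_i w i *: v i = 0 -> forall i, w i = 0.

(* The vertices of a polytope are its extreme points. *)
Definition vertices P : set 'rV[R]_d :=
  [set x | P x /\ forall (y z : 'rV[R]_d) (t : R), P y -> P z ->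
             0 < t < 1 -> x = t *: y + (1 - t) *: z -> y = x /\ z = x].

(* A family of d + 1 affinely independent points spans R^d affinely, so
   these simplices are nondegenerate. *)
Definition simplex T : Prop :=
  exists2 v, affinely_independent v & T = convex_hull (range v).

Definition lattice_simplex T : Prop := simplex T /\ vertices T `<=` lattice.

Definition boundary P : set 'rV[R]_d := closure P `\` interior P.

Definition clean P : Prop := boundary P `&` lattice `<=` vertices P.

Definition clean_lattice_simplices (k : nat) : set (set 'rV[R]_d) :=
  [set T | [/\ lattice_simplex T, clean T &
                (interior T `&` lattice #= `I_k)%card]].

Definition line (A : set 'rV[R]_d) : Prop :=
  exists p u : 'rV[R]_d, u != 0 /\ A = [set p + t *: u | t in [set: R]].

End LatticeSimplices.

Arguments lattice {R d}.
Arguments clean_lattice_simplices : clear implicits.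

(* Main.v *)
From HB Require Import structures.
Require Import Defs.
From mathcomp Require Import all_boot all_order all_algebra.
From mathcomp Require Import zify ring lra.
Set Implicit Arguments.
Unset Strict Implicit.
Unset Printing Implicit Defensive.
Import Order.TTheory GRing.Theory Num.Theory.
Local Open Scope ring_scope.

(** Points are described by their barycentric coordinates with respect to the
    [n = d + 1] vertices of [T]: rows of length [n] whose entries add up to 1.
    If the rows of [W] are lattice points, the simplex that they span has
    normalized volume ([d!] times the volume) [N * |det W|], where [N] is the
    normalized volume of [T]; this is an integer, so it is at least 1 when the
    simplex is nondegenerate.

    Cutting a simplex from a lattice point in the relative interior of one of
    its [m]-dimensional faces produces [m + 1] simplices in the place of one.
    Cutting successively from several lattice points therefore shows that a
    lattice simplex has normalized volume at least 1 plus the sum, over its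
    lattice points other than the vertices, of the dimensions of the faces in
    whose relative interiors they lie ([cell_bound]).  For [T], with [k]
    interior points, this reads [N >= d k + 1], and equality is assumed.  So
    nothing can be lost in any way of cutting up [T].  Two ways are used.

    - From one interior lattice point [x].  The cone from [x] over the facet
      opposite to vertex [i] has normalized volume [N * x_i], which is thus
      known exactly from the position of the other points ([star_volume]).  In
      particular the lattice point nearest to a facet spans with it a simplex
      of normalized volume 1, and any lattice point is, modulo integers, a
      multiple of that nearest point ([nearest_multiple]).

    - From two interior lattice points [x] and [y].  If the ratios [y_a / x_a]
      with [a] in [A] are smaller than those with [b] outside [A], then [T] is
      cut into [|A| |B| + n] simplices, with [B] the complement of [A], and
      tightness forces [|A| |B| <= d] ([split_card]).  As [|A| + |B| = d + 1],
      one of the two sets is a singleton: there are never two ratios that are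
      both smaller than two others ([ratio_no_two_two]).

    Suppose that some [x] is nearest to two facets [i] and [j].  For any other
    [q] the ratio [q / x] is largest both at [i] and at [j], hence it is
    constant except at a single index [l]; a comparison of masses gives
    [x_l > 1/2], so [l] is the same for all [q], and all points lie on the line
    through [x] and vertex [l] ([collinear_of_common_nearest]).

    Such an [x] exists ([common_nearest]).  If the points nearest to the
    different facets were all different, one would compare the coordinates at
    two further indices [l] and [m] of the points nearest to [i] and to [j];
    this is where [d >= 3] enters.  The count behind [star_volume] has then only
    two kinds of contributions, and forces two of these coordinates to be equal,
    from which [nearest_multiple] derives that two nearest points coincide.

    What remains is to identify the measure of a simplex with a determinant
    ([Vol_hull]).  Affine maps scale volume by their determinant
    ([scales_affine]), by induction on the dimension from the one-dimensional
    case and Tonelli's theorem; the corner simplex is computed by slicing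
    ([Vol_corner]). *)

(** * Replacing a row of a matrix *)

Lemma exists_notin n (s : seq 'I_n) : (size s < n)%N -> exists m, m \notin s.
Proof.
move=> sn; apply/existsP; rewrite -negb_forall; apply/negP => /forallP all_s.
have := leq_ltn_trans (card_size s) sn.
by rewrite (eq_card (_ : _ =i 'I_n)) ?card_ord ?ltnn // => m; rewrite all_s.
Qed.

Section RowReplacement.
Context (R : comUnitRingType) (n : nat).
Implicit Types (W : 'M[R]_n) (p c : 'rV[R]_n) (i : 'I_n).

Definition repl W i p : 'M[R]_n :=
  \matrix_(r, s) (if r == i then p 0 s else W r s).

Lemma row_repl W i p j :
  row j (repl W i p) = if j == i then p else row j W.
Proof.
apply/rowP=> s; rewrite !mxE; case: eqP => // _; by rewrite !mxE.
Qed.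

Lemma mul_repl W i p c :
  c *m repl W i p = c *m W + c 0 i *: (p - row i W).
Proof.
rewrite mulmx_sum_row [in RHS]mulmx_sum_row (bigD1 i) //= [in RHS](bigD1 i) //=.
rewrite row_repl eqxx scalerBr addrAC addrCA subrr addr0; congr (_ + _).
by apply: eq_bigr => j ji; rewrite row_repl (negbTE ji).
Qed.

Lemma det_repl W i p : \det (repl W i p) = (p *m \adj W) 0 i.
Proof.
rewrite (expand_det_row _ i) mxE; apply: eq_bigr => j _.
rewrite !mxE eqxx /cofactor; congr (_ * (_ * \det _)).
by apply/matrixP=> r s; rewrite !mxE eq_sym (negbTE (neq_lift _ _)).
Qed.

Lemma det_repl_mul W i c : \det (repl W i (c *m W)) = c 0 i * \det W.
Proof.
by rewrite det_repl -mulmxA mul_mx_adj mul_mx_scalar mxE mulrC.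
Qed.

Lemma det_repl1 i p : \det (repl 1%:M i p) = p 0 i.
Proof. by rewrite -{1}[p]mulmx1 det_repl_mul det1 mulr1. Qed.

End RowReplacement.

(** * The volume of a lattice simplex and its lattice points *)

Section CellBound.
Context (R : archiRealFieldType) (n : nat).
Implicit Types (W : 'M[R]_n) (p q c f : 'rV[R]_n) (i : 'I_n) (t N : R).

Lemma unitmx_det W : (W \in unitmx) = (\det W != 0).
Proof. by rewrite unitmxE unitfE. Qed.

Lemma unitmx_repl W i c :
  W \in unitmx -> c 0 i != 0 -> repl W i (c *m W) \in unitmx.
Proof. by rewrite !unitmx_det det_repl_mul => W0 ci; rewrite mulf_neq0. Qed.

Definition mass p := \sum_i p 0 i.

Definition supp c : {set 'I_n} := [set i | c 0 i != 0].

(** If [q] lies in the simplex with vertices the rows of [W], this is the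
    dimension of the face whose relative interior contains [q]; otherwise it
    is 0. *)
Definition weight W q : nat :=
  let c := q *m invmx W in
  if [forall i, 0 <= c 0 i] then #|supp c|.-1 else 0.

Lemma massD p q : mass (p + q) = mass p + mass q.
Proof. by rewrite /mass -big_split; apply: eq_bigr => i _; rewrite mxE. Qed.

Lemma massZ a p : mass (a *: p) = a * mass p.
Proof. by rewrite /mass mulr_sumr; apply: eq_bigr => i _; rewrite mxE. Qed.

Lemma mass_mul c W : (forall i, mass (row i W) = 1) -> mass (c *m W) = mass c.
Proof.
move=> W1; rewrite mulmx_sum_row.
rewrite (big_morph mass massD (_ : mass 0 = 0)); last first.
  by rewrite /mass big1 // => i _; rewrite mxE.
by apply: eq_bigr => i _; rewrite massZ W1 mulr1.
Qed.

Lemma weight_mul W c : W \in unitmx -> (forall i, 0 <= c 0 i) ->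
  weight W (c *m W) = #|supp c|.-1.
Proof.
by move=> uW c0; rewrite /weight mulmxK // ifT //; apply/forallP.
Qed.

Lemma card_supp_add f i t : f 0 i = 0 ->
  #|supp (f + t *: delta_mx 0 i)| = (#|supp f| + (t != 0%R))%N.
Proof.
move=> fi; have gE j : (f + t *: delta_mx 0 i) 0 j = f 0 j + t * (j == i)%:R.
  by rewrite !mxE eqxx.
have [tz|tn0] := eqVneq t 0.
  by rewrite addn0 tz scale0r addr0.
rewrite (_ : supp _ = i |: supp f) ?cardsU1 ?inE ?fi ?eqxx ?addn1 ?add1n //.
apply/setP=> j; rewrite !inE gE; have [->|ji] := eqVneq j i.
  by rewrite fi mulr1 add0r tn0.
by rewrite mulr0 addr0.
Qed.

(** This is the induction step for counting: when a cell [W] is cut from a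
    point of it, the weight of any other point is at most the sum of its weights
    in the pieces.  With [c] and [e] the coordinates of the two points, let [t]
    be the least ratio [e_i / c_i] over the support of [c], attained on [I].  The
    pieces obtained by replacing a row in [I] are those containing [q], and its
    coordinates there are those of [f = e - t c] together with [t]; so [q] has the
    same weight in each of these [#|I|] pieces. *)
Lemma weight_repl W c q : W \in unitmx -> (forall i, 0 <= c 0 i) ->
  mass (c *m W) = 1 -> mass q = 1 -> q != c *m W ->
  (weight W q <= \sum_(i in supp c) weight (repl W i (c *m W)) q)%N.
Proof.
move=> uW c0 p1 q1 qp.
set p := c *m W in p1 qp *.
rewrite {1}/weight; set e := q *m invmx W.
case: ifP => [/forallP e0|//].
have qE : q = e *m W by rewrite mulmxKV.
have cn0 : c != 0.
  apply: contraPneq p1 => c_0; rewrite /p c_0 mul0mx /mass big1 => [|i _].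
    by apply/eqP; rewrite eq_sym oner_eq0.
  by rewrite mxE.
have [i0 i0c] : exists i, i \in supp c.
  have /rV0Pn[i ci] := cn0; by exists i; rewrite inE.
pose F i : R := e 0 i / c 0 i.
have [i1 i1c i1min] : exists2 i1, i1 \in supp c & forall i, i \in supp c -> F i1 <= F i.
  by case: (arg_minP F i0c) => i1 ? ?; exists i1.
pose t := F i1; pose f : 'rV[R]_n := e - t *: c.
have cpos i : i \in supp c -> 0 < c 0 i.
  by rewrite inE => ci; rewrite lt_def ci c0.
have t0 : 0 <= t by rewrite divr_ge0.
have fE i : f 0 i = e 0 i - t * c 0 i by rewrite !mxE.
have f0 i : 0 <= f 0 i.
  rewrite fE subr_ge0; have [ic|] := boolP (i \in supp c).
    by rewrite -ler_pdivlMr ?cpos ?i1min.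
  by rewrite inE negbK => /eqP ->; rewrite mulr0 e0.
pose I := [set i in supp c | f 0 i == 0].
have i1I : i1 \in I.
  apply/setIdP; split; first exact: i1c.
  by rewrite fE /t /F divfK ?subrr ?eqxx // gt_eqF // cpos.
have qf : q = f *m W + t *: p.
  by rewrite mulmxBl -scalemxAl -qE /p addrNK.
have fn0 : f != 0.
  apply/eqP=> f_0; move: qf; rewrite f_0 mul0mx add0r => qt.
  have t1 : t = 1 by move: q1; rewrite qt massZ p1 mulr1.
  by move: qp; rewrite qt t1 scale1r eqxx.
have sf : (0 < #|supp f|)%N.
  by have /rV0Pn[i ci] := fn0; rewrite card_gt0; apply/set0Pn; exists i; rewrite inE.
have wI i : i \in I -> weight (repl W i p) q = (#|supp f| + (t != 0%R)).-1%N.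
  rewrite inE => /andP[ic /eqP fi].
  pose g : 'rV[R]_n := f + t *: delta_mx 0 i.
  have gE j : g 0 j = f 0 j + t * (j == i)%:R by rewrite !mxE eqxx.
  have gi : g 0 i = t by rewrite gE fi eqxx mulr1 add0r.
  have -> : q = g *m repl W i p.
    rewrite mul_repl gi /g mulmxDl -scalemxAl -rowE scalerBr qf.
    by rewrite -addrA [X in _ = _ + X]addrC subrK.
  have ge0 j : 0 <= g 0 j.
    by rewrite gE; exact: addr_ge0 (f0 j) (mulr_ge0 t0 (ler0n _ _)).
  have ru : repl W i p \in unitmx.
    by apply: unitmx_repl => //; rewrite gt_eqF // cpos.
  rewrite weight_mul //.
  by rewrite /g card_supp_add.
have cI : (0 < #|I|)%N by rewrite card_gt0; apply/set0Pn; exists i1.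
rewrite (big_setID I) /= (setIidPr (_ : I \subset supp c)); last first.
  by apply/subsetP=> i /setIdP[].
apply: leq_trans (leq_addr _ _).
rewrite (eq_bigr (fun=> (#|supp f| + (t != 0%R)).-1%N)) // sum_nat_const.
have eE i : e 0 i = f 0 i + t * c 0 i by rewrite fE subrK.
(* The supports of f and e agree off I, so what is left is the inequality
   a + b - 1 <= a * b between the sizes of I and of the support of f. *)
have : (#|supp e| <= #|supp f| + (t != 0%R) * #|I|)%N.
  have [tz|tn0] := eqVneq t 0.
    rewrite addn0; apply: subset_leq_card; apply/subsetP=> i; rewrite !inE eE tz.
    by rewrite mul0r addr0.
  rewrite mul1n; apply: leq_trans (leq_card_setU _ _); apply: subset_leq_card.
  apply/subsetP=> i; rewrite !inE eE; have [->/=|//] := eqVneq (f 0 i) 0.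
  by rewrite add0r mulf_eq0 (negbTE tn0) /= andbT.
case: #|supp f| sf => // m _; case: #|I| cI => // k _.
by case: (t != 0%R) => /=; rewrite ?addn1 ?addn0 /= ?mul1n ?mul0n mulSn; nia.
Qed.

(** [lat] stands for the lattice points written in barycentric coordinates
    with respect to a lattice simplex of normalized volume [N]. *)
Definition barycentric_lattice N (lat : 'rV[R]_n -> Prop) : Prop :=
  [/\ forall x, lat x -> mass x = 1,
      forall i, lat (delta_mx 0 i) &
      forall W, (forall i, lat (row i W)) -> N * \det W \is a Num.int].

(** Each point of [Q] that lies in the cell cuts it into one piece per
    positive coordinate; the volumes of the pieces add up, and by [weight_repl]
    no weight of the remaining points is lost.  Points outside the cell have
    weight 0 and may be dropped. *)
Lemma cell_bound N lat W (Q : seq 'rV[R]_n) :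
  0 < N -> barycentric_lattice N lat ->
  (forall i, lat (row i W)) -> W \in unitmx ->
  uniq Q -> (forall q, q \in Q -> lat q) ->
  (forall q, q \in Q -> forall i, q != row i W) ->
  1 + (\sum_(q <- Q) weight W q)%:R <= N * `|\det W|.
Proof.
move=> N0 [lat1 _ latZ]; elim: Q W => [|p Q IH] W latW uW /=.
  move=> _ _ _; rewrite big_nil addr0 -[N]gtr0_norm // -normrM norm_intr_ge1 ?latZ //.
  by rewrite mulf_neq0 -?unitmx_det // gt_eqF.
move=> /andP[pQ uQ] latQ Qrow.
have latp : lat p by apply: latQ; rewrite mem_head.
have {}latQ q : q \in Q -> lat q by move=> qQ; apply: latQ; rewrite inE qQ orbT.
have prow i : p != row i W by apply: Qrow; rewrite mem_head.
have {}Qrow q : q \in Q -> forall i, q != row i W.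
  by move=> qQ; apply: Qrow; rewrite inE qQ orbT.
rewrite big_cons; have [wp0|wp] := posnP (weight W p).
  by rewrite wp0 add0n; apply: IH.
pose c := p *m invmx W.
have pE : p = c *m W by rewrite mulmxKV.
have c0 i : 0 <= c 0 i.
  by move: wp; rewrite /weight; case: ifP => // /forallP/(_ i).
have dE i : \det (repl W i p) = c 0 i * \det W by rewrite pE det_repl_mul.
have wpE : weight W p = #|supp c|.-1 by rewrite pE weight_mul.
have mc : mass c = 1.
  by rewrite -(lat1 _ latp) pE mass_mul // => i; apply: lat1.
have -> : N * `|\det W| = \sum_(i in supp c) N * `|\det (repl W i p)|.
  rewrite -mulr_sumr; congr (_ * _); rewrite -[LHS]mul1r -{1}mc mulr_suml big_mkcond /=.
  rewrite [RHS]big_mkcond; apply: eq_bigr => i _.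
  rewrite inE /= dE normrM ger0_norm //; case: eqP => //= ->.
  by rewrite mul0r.
have step i : i \in supp c ->
    1 + (\sum_(q <- Q) weight (repl W i p) q)%:R <= N * `|\det (repl W i p)|.
  move=> ic; apply: IH => //.
  - by move=> j; rewrite row_repl; case: eqP.
  - by rewrite pE unitmx_repl //; move: ic; rewrite inE.
  - move=> q qQ j; rewrite row_repl; case: (j == i); last exact: (Qrow q qQ).
    by apply: contraNneq pQ => <-.
apply: le_trans (ler_sum _ step).
rewrite big_split /= sumr_const -natr_sum -natrD -[1]/(1%:R) -natrD ler_nat.
rewrite exchange_big /=.
have sc : (0 < #|supp c|)%N by move: wp; rewrite wpE; case: #|_|.
have : (\sum_(q <- Q) weight W q <=
        \sum_(q <- Q) \sum_(i in supp c) weight (repl W i p) q)%N.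
  rewrite big_seq [X in (_ <= X)%N]big_seq; apply: leq_sum => q qQ.
  rewrite pE; apply: weight_repl => //; rewrite -?pE; try exact: lat1.
    by apply: lat1; apply: latQ.
  by apply: contraNneq pQ => <-.
by rewrite wpE addnA add1n prednK // leq_add2l.
Qed.

End CellBound.

(** * The weight of a point in the cells cut out from one or two points *)

Section Cells.
Context (R : archiRealFieldType) (n : nat).
Implicit Types (x y q f : 'rV[R]_n) (i a b : 'I_n) (s r t : R).

(** Subtracting from [q] the multiple of [x] that first meets a facet leaves
    a point of that facet; so a vanishing coordinate of the difference at [i]
    says that [q] is in the cone from [x] over facet [i]. *)
Lemma weight_repl1 x q i t :
  x 0 i != 0 -> 0 <= t -> (forall j, t * x 0 j <= q 0 j) -> q 0 i = t * x 0 i ->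
  weight (repl 1%:M i x) q = (#|supp (q - t *: x)| + (t != 0%R)).-1.
Proof.
move=> xi t0 le_q qi; set f := q - t *: x.
have fE j : f 0 j = q 0 j - t * x 0 j by rewrite !mxE.
have fi : f 0 i = 0 by rewrite fE qi subrr.
have qE : q = (f + t *: delta_mx 0 i) *m repl 1%:M i x.
  have gi : (f + t *: delta_mx 0 i) 0 i = t by rewrite mxE fi !mxE !eqxx mulr1 add0r.
  rewrite mul_repl gi mulmx1 rowE mulmx1 scalerBr addrA addrAC addrK.
  by rewrite subrK.
rewrite {1}qE weight_mul ?card_supp_add //.
  by rewrite unitmx_det det_repl1.
move=> j; rewrite !mxE; apply: addr_ge0; last by rewrite mulr_ge0 // ler0n.
by have := fE j; rewrite !mxE => ->; rewrite subr_ge0.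
Qed.

(** The volume of the cell in which [x] replaces vertex [a] and [y] replaces
    vertex [b]. *)
Lemma det_repl2 x y a b : a != b -> x 0 a != 0 ->
  \det (repl (repl 1%:M a x) b y) = x 0 a * y 0 b - x 0 b * y 0 a.
Proof.
move=> ab xa; pose c := y - (y 0 a / x 0 a) *: x + (y 0 a / x 0 a) *: delta_mx 0 a.
have cE j : c 0 j = y 0 j - y 0 a / x 0 a * x 0 j + y 0 a / x 0 a * (j == a)%:R.
  by rewrite !mxE eqxx.
have yE : y = c *m repl 1%:M a x.
  have ca : c 0 a = y 0 a / x 0 a by rewrite cE eqxx mulr1 divfK // subrr add0r.
  rewrite mul_repl ca mulmx1 rowE mulmx1 scalerBr addrA addrAC addrK.
  by rewrite subrK.
rewrite {1}yE det_repl_mul det_repl1 cE eq_sym (negbTE ab) mulr0 addr0.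
by field.
Qed.

Lemma weight_repl2 x y q a b s r :
  a != b -> x 0 a != 0 -> x 0 a * y 0 b - x 0 b * y 0 a != 0 ->
  0 <= s -> 0 <= r -> (forall j, s * x 0 j + r * y 0 j <= q 0 j) ->
  q 0 a = s * x 0 a + r * y 0 a -> q 0 b = s * x 0 b + r * y 0 b ->
  weight (repl (repl 1%:M a x) b y) q =
  (#|supp (q - s *: x - r *: y)| + (s != 0%R) + (r != 0%R)).-1.
Proof.
move=> ab xa d0 s0 r0 le_q qa qb; set f := q - s *: x - r *: y.
have fE j : f 0 j = q 0 j - s * x 0 j - r * y 0 j by rewrite !mxE.
have fa : f 0 a = 0 by rewrite fE qa; ring.
have fb : f 0 b = 0 by rewrite fE qb; ring.
pose g : 'rV[R]_n := f + s *: delta_mx 0 a + r *: delta_mx 0 b.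
have gE j : g 0 j = f 0 j + s * (j == a)%:R + r * (j == b)%:R by rewrite !mxE eqxx.
have qE : q = g *m repl (repl 1%:M a x) b y.
  have ga : g 0 a = s by rewrite gE fa eqxx (negbTE ab) /=; ring.
  have gb : g 0 b = r by rewrite gE fb eqxx [b == a]eq_sym (negbTE ab) /=; ring.
  rewrite !mul_repl ga gb row_repl [b == a]eq_sym (negbTE ab) !rowE !mulmx1.
  by apply/rowP=> j; rewrite mxE [in RHS]mxE gE fE !mxE eqxx; ring.
rewrite {1}qE weight_mul /g ?card_supp_add //.
- by rewrite !mxE eqxx [b == a]eq_sym (negbTE ab) mulr0 addr0 -[RHS]fb !mxE.
- by rewrite unitmx_det det_repl2.
move=> j; rewrite -/g gE; do !apply: addr_ge0.
- by rewrite fE -addrA -opprD subr_ge0.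
- by rewrite mulr_ge0 // ler0n.
- by rewrite mulr_ge0 // ler0n.
Qed.

End Cells.

Lemma leq_sum_const (I : finType) (P Q : {set I}) (F : I -> nat) m :
  Q \subset P -> (forall i, i \in Q -> (m <= F i)%N) ->
  (#|Q| * m <= \sum_(i in P) F i)%N.
Proof.
move=> QP mF; rewrite (big_setID Q) /= (setIidPr QP) -sum_nat_const.
by apply: leq_trans (leq_addr _ _); apply: leq_sum.
Qed.

Lemma leq_sum2_const (I J : finType) (P Q : {set I}) (P' Q' : {set J})
    (F : I -> J -> nat) m :
  Q \subset P -> Q' \subset P' ->
  (forall i j, i \in Q -> j \in Q' -> (m <= F i j)%N) ->
  (#|Q| * (#|Q'| * m) <= \sum_(i in P) \sum_(j in P') F i j)%N.
Proof.
move=> QP QP' mF; apply: leq_sum_const => // i iQ.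
by apply: leq_sum_const => // j jQ; apply: mF.
Qed.

Lemma pred_add_leq_mul m p : (0 < m)%N -> (0 < p)%N -> ((m + p).-1 <= m * p)%N.
Proof. by case: m => // m _; case: p => // p _; rewrite mulSn; nia. Qed.

(** * Covering a point by the cells cut out from two points *)

Section Cover.
Context (R : archiRealFieldType) (n : nat).
Implicit Types (x y q f : 'rV[R]_n) (i a b : 'I_n) (s r t : R) (A : {set 'I_n}).

Definition all_positive x := forall i, 0 < x 0 i.

(** The facets over which the cone from [x] contains [q]: the indices at
    which [q i / x i] is least.  The quotient is avoided so that membership is a
    polynomial condition. *)
Definition lowest x q : {set 'I_n} :=
  [set i | [forall j, q 0 i * x 0 j <= q 0 j * x 0 i]].

Lemma lowestP x q i :
  reflect (forall j, q 0 i * x 0 j <= q 0 j * x 0 i) (i \in lowest x q).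
Proof. by rewrite inE; apply: forallP. Qed.

Lemma lowest_neq0 x q (i0 : 'I_n) : all_positive x -> lowest x q != set0.
Proof.
move=> x0; have /= := @arg_minP _ _ _ i0 xpredT (fun i => q 0 i / x 0 i) isT.
case=> i _ imin; apply/set0Pn; exists i; apply/lowestP=> j.
by rewrite -ler_pdivrMr // mulrAC -ler_pdivlMr // imin.
Qed.

(** Proportional points of equal mass are equal. *)
Lemma lowest_neqT x q : all_positive x -> all_positive q -> mass x = 1 -> mass q = 1 ->
  q != x -> (#|lowest x q| < n)%N.
Proof.
move=> x0 q0 x1 q1; apply: contraNT; rewrite -leqNgt => nM.
have MT : lowest x q = setT.
  by apply/eqP; rewrite eqEcard subsetT cardsT card_ord.
have qx i j : q 0 i * x 0 j = q 0 j * x 0 i.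
  apply/eqP; rewrite eq_le; apply/andP; split.
    by have /lowestP : i \in lowest x q by rewrite MT inE.
  by have /lowestP : j \in lowest x q by rewrite MT inE.
apply/eqP/rowP=> i; rewrite -[LHS]mulr1 -x1 -[RHS]mul1r -q1 mulr_sumr mulr_suml.
by apply: eq_bigr => j _.
Qed.

Lemma weight_lowest x q i : all_positive x -> all_positive q -> i \in lowest x q ->
  weight (repl 1%:M i x) q = (n - #|lowest x q|)%N /\
  #|supp (q - (q 0 i / x 0 i) *: x)| = (n - #|lowest x q|)%N.
Proof.
move=> x0 q0 iM; have /lowestP imin := iM; set t := q 0 i / x 0 i.
have t0 : 0 < t by rewrite divr_gt0.
have le_q j : t * x 0 j <= q 0 j by rewrite /t mulrAC ler_pdivrMr.
have sE : #|supp (q - t *: x)| = (n - #|lowest x q|)%N.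
  rewrite cardsCs card_ord; congr (_ - #|pred_of_set _|)%N; apply/setP=> j.
  rewrite in_setC !inE !mxE negbK subr_eq0; apply/eqP/forallP=> [qj l|jmin].
    by rewrite qj mulrAC ler_wpM2r ?le_q // ltW.
  apply/eqP; rewrite eq_le le_q andbT.
  by rewrite /t mulrAC ler_pdivlMr.
have qi : q 0 i = t * x 0 i by rewrite /t divfK // gt_eqF.
by rewrite (weight_repl1 (lt0r_neq0 (x0 i)) (ltW t0) le_q qi) sE gt_eqF // addn1.
Qed.

(** Here [(s, r)] is a vertex of the polygon of pairs with [s x + r y <= q],
    at which a constraint with index in [A] meets one with index in [~: A].
    For given [a] and [b] the two equations have a unique solution, whose second
    component is [r_ a b]; the pair sought is a minimax of [r_].  Taking the
    maximum over [a] makes the constraints in [A] hold, and the minimum over [b]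
    of these maxima makes those in [~: A] hold.  The two inclusions of lowest
    indices ensure that [s] and [r] are positive. *)
Lemma touching_point x y q A :
  all_positive x -> all_positive y -> all_positive q ->
  A != set0 -> ~: A != set0 ->
  (forall a b, a \in A -> b \in ~: A -> y 0 a * x 0 b < y 0 b * x 0 a) ->
  lowest x q \subset A -> lowest y q \subset ~: A ->
  exists s r a b, [/\ 0 < s /\ 0 < r, a \in A, b \in ~: A,
    q 0 a = s * x 0 a + r * y 0 a /\ q 0 b = s * x 0 b + r * y 0 b &
    forall i, s * x 0 i + r * y 0 i <= q 0 i].
Proof.
move=> x0 y0 q0 /set0Pn[a1 a1A] /set0Pn[b1 b1B] AB xA yB.
pose D a b := x 0 a * y 0 b - x 0 b * y 0 a.
pose S a b := x 0 a * q 0 b - x 0 b * q 0 a.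
pose r_ a b := S a b / D a b.
have D0 a b : a \in A -> b \in ~: A -> 0 < D a b.
  by move=> aA bB; rewrite subr_gt0 mulrC [ltRHS]mulrC AB.
pose top b := [arg max_(a > a1 | a \in A) r_ a b]%O.
have topA b : top b \in A by rewrite /top; case: arg_maxP.
have topP b a : a \in A -> r_ a b <= r_ (top b) b.
  by rewrite /top; case: arg_maxP => // i _ + aA; apply.
pose b := [arg min_(b < b1 | b \in ~: A) r_ (top b) b]%O.
have bB : b \in ~: A by rewrite /b; case: arg_minP.
have bP c : c \in ~: A -> r_ (top b) b <= r_ (top c) c.
  by rewrite {1 2}/b; case: arg_minP => // i _ + cB; apply.
pose a := top b; pose r := r_ a b; pose s := (q 0 b - r * y 0 b) / x 0 b.
have aA : a \in A := topA b.
have sb : s * x 0 b = q 0 b - r * y 0 b by rewrite divfK // gt_eqF.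
have le_A c : c \in A -> s * x 0 c <= q 0 c - r * y 0 c.
  move=> cA; have := topP b c cA; rewrite -/a -/r ler_pdivrMr ?D0 // /S /D => le.
  rewrite -(ler_pM2r (x0 b)) mulrAC sb; nra.
have eq_a : s * x 0 a = q 0 a - r * y 0 a.
  apply: (mulIf (lt0r_neq0 (x0 b))); rewrite mulrAC sb.
  have : r * D a b = S a b by rewrite divfK // gt_eqF // D0.
  by rewrite /D /S; nra.
have le_B c : c \in ~: A -> s * x 0 c <= q 0 c - r * y 0 c.
  move=> cB; have := bP c cB; rewrite -/a -/r ler_pdivlMr ?D0 // /S /D => le.
  have le2 := le_A _ (topA c).
  rewrite -(ler_pM2r (x0 (top c))).
  have := x0 c; have := x0 (top c); nra.
have le_q i : s * x 0 i + r * y 0 i <= q 0 i.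
  rewrite -lerBrDr; have [iA|iB] := boolP (i \in A); first exact: le_A.
  by apply: le_B; rewrite inE.
have r0 : 0 <= r.
  have /set0Pn[i iM] := lowest_neq0 q a1 x0.
  have iA := subsetP xA _ iM; have /lowestP imin := iM.
  apply: le_trans (topP b i iA); rewrite divr_ge0 ?(ltW (D0 _ _ _ _)) //.
  by rewrite subr_ge0 mulrC [leRHS]mulrC.
have s0 : 0 <= s.
  have /set0Pn[i iM] := lowest_neq0 q a1 y0.
  have iB := subsetP yB _ iM; have /lowestP imin := iM.
  have ry : r * y 0 i <= q 0 i.
    have := bP i iB; rewrite -/a -/r => le.
    have {}le : r * y 0 i <= r_ (top i) i * y 0 i by rewrite ler_pM2r.
    apply: le_trans le _; rewrite /r_ mulrAC ler_pdivrMr ?D0 // /S /D.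
    have := imin (top i); have := x0 i; nra.
  have : 0 <= s * x 0 a * y 0 i.
    rewrite eq_a; have := imin a; have := y0 a; nra.
  by rewrite -mulrA pmulr_lge0 // mulr_gt0.
exists s, r, a, b; split => //; last 1 first.
- by rewrite eq_a sb !subrK.
rewrite !lt_def s0 r0 !andbT; split.
- apply/eqP=> sz; have : a \in lowest y q.
    apply/lowestP=> j; have := le_q j; have := eq_a; rewrite sz !mul0r add0r.
    move=> /eqP; rewrite eq_sym subr_eq0 => /eqP -> le.
    rewrite mulrAC ler_wpM2r // ltW //.
  by move/(subsetP yB); rewrite inE aA.
- apply/eqP=> rz; have : b \in lowest x q.
    apply/lowestP=> j; have := le_q j; have := sb; rewrite rz !mul0r subr0 addr0 => <- le.
    rewrite mulrAC ler_wpM2r // ltW //.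
  by move/(subsetP xA) => bA; move: bB; rewrite inE bA.
Qed.

(** The cells of the dissection along the segment from [x] to [y] are: [x] in
    the place of a vertex outside [A], [y] in the place of a vertex in [A], and
    both at once.  Every other interior point has total weight at least [n.-1] in
    them.  If an index outside [A] is lowest for [x], the cone from [x] over that
    facet is a cell containing [q], and similarly for [y] and [A]; otherwise
    [touching_point] puts [q] in cells of the third kind.  In each case the
    number of cells containing [q], times its weight in each of them, is bounded
    below by [pred_add_leq_mul]. *)
Lemma pair_weight x y q A :
  all_positive x -> all_positive y -> all_positive q ->
  mass x = 1 -> mass y = 1 -> mass q = 1 -> q != x -> q != y ->
  A != set0 -> ~: A != set0 ->
  (forall a b, a \in A -> b \in ~: A -> y 0 a * x 0 b < y 0 b * x 0 a) ->
  (n.-1 <= \sum_(b in ~: A) weight (repl 1%:M b x) q +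
           \sum_(a in A) weight (repl 1%:M a y) q +
           \sum_(a in A) \sum_(b in ~: A) weight (repl (repl 1%:M a x) b y) q)%N.
Proof.
move=> x0 y0 q0 x1 y1 q1 qx qy A0 B0 AB.
have D0 a b : a \in A -> b \in ~: A -> x 0 a * y 0 b - x 0 b * y 0 a != 0.
  by move=> aA bB; rewrite gt_eqF // subr_gt0 mulrC [ltRHS]mulrC AB.
have neq a b : a \in A -> b \in ~: A -> a != b.
  by move=> aA; rewrite inE; apply: contraNneq => <-.
have Mn z : all_positive z -> mass z = 1 -> q != z -> (#|lowest z q| < n)%N.
  by move=> *; apply: lowest_neqT.
have spl (M : {set 'I_n}) : #|M| = (#|M :&: A| + #|M :&: ~: A|)%N.
  by rewrite -(cardsID A M) setDE.
have [xA|xB] := boolP (lowest x q \subset A); last first.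
  set M := lowest x q in xB *; have {Mn} := Mn x x0 x1 qx; rewrite -/M => Mn.
  have MB : (0 < #|M :&: ~: A|)%N.
    by move: xB; rewrite card_gt0 -setDE setD_eq0.
  have H1 : (#|M :&: ~: A| * (n - #|M|) <= \sum_(b in ~: A) weight (repl 1%:M b x) q)%N.
    apply: leq_sum_const; first exact: subsetIr.
    by move=> b; rewrite inE => /andP[bM _]; have [-> _] := weight_lowest x0 q0 bM.
  have H2 : (#|M :&: A| * (#|M :&: ~: A| * (n - #|M|)) <=
      \sum_(a in A) \sum_(b in ~: A) weight (repl (repl 1%:M a x) b y) q)%N.
    apply: leq_sum2_const; [exact: subsetIr|exact: subsetIr|].
    move=> a b /setIP[aM aA] /setIP[bM bB].
    have [_ sE] := weight_lowest x0 q0 aM.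
    have t0 : 0 < q 0 a / x 0 a by rewrite divr_gt0.
    have /lowestP amin := aM; have /lowestP bmin := bM.
    set t := q 0 a / x 0 a in t0 sE.
    have le_q j : t * x 0 j + 0 * y 0 j <= q 0 j.
      by rewrite mul0r addr0 mulrAC ler_pdivrMr.
    have qa : q 0 a = t * x 0 a + 0 * y 0 a by rewrite mul0r addr0 divfK // gt_eqF.
    have qb : q 0 b = t * x 0 b + 0 * y 0 b.
      apply/eqP; rewrite eq_le le_q mul0r addr0 mulrAC ler_pdivlMr // andbT.
      exact: bmin.
    rewrite (weight_repl2 (neq _ _ aA bB) (lt0r_neq0 (x0 a)) (D0 _ _ aA bB)
      (ltW t0) (lexx 0) le_q qa qb).
    by rewrite scale0r subr0 sE eqxx gt_eqF // addn0 addn1.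
  apply: leq_trans (leq_add (leq_trans H1 (leq_addr _ _)) H2).
  have M0 : (0 < #|M|)%N by rewrite spl ltn_addl.
  (* With u and v the sizes of M inside and outside A, the number of cells
     is v + u * v, which is at least u + v because v > 0. *)
  have := pred_add_leq_mul M0 (_ : (0 < n - #|M|)%N); rewrite subn_gt0 => /(_ Mn).
  rewrite subnKC ?(ltnW Mn) // => /leq_trans; apply.
  rewrite mulnA -mulnDl leq_mul2r; apply/orP; right; rewrite (spl M).
  by case: #|M :&: ~: A| MB => // v _; nia.
have [yB|yA] := boolP (lowest y q \subset ~: A); last first.
  set M := lowest y q in yA *; have {Mn} := Mn y y0 y1 qy; rewrite -/M => Mn.
  have MA : (0 < #|M :&: A|)%N.
    by move: yA; rewrite card_gt0 -[A in M :&: A]setCK -setDE setD_eq0.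
  have H1 : (#|M :&: A| * (n - #|M|) <= \sum_(a in A) weight (repl 1%:M a y) q)%N.
    apply: leq_sum_const; first exact: subsetIr.
    by move=> a; rewrite inE => /andP[aM _]; have [-> _] := weight_lowest y0 q0 aM.
  have H2 : (#|M :&: A| * (#|M :&: ~: A| * (n - #|M|)) <=
      \sum_(a in A) \sum_(b in ~: A) weight (repl (repl 1%:M a x) b y) q)%N.
    apply: leq_sum2_const; [exact: subsetIr|exact: subsetIr|].
    move=> a b /setIP[aM aA] /setIP[bM bB].
    have [_ sE] := weight_lowest y0 q0 aM.
    have t0 : 0 < q 0 a / y 0 a by rewrite divr_gt0.
    have /lowestP amin := aM; have /lowestP bmin := bM.
    set t := q 0 a / y 0 a in t0 sE.
    have le_q j : 0 * x 0 j + t * y 0 j <= q 0 j.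
      by rewrite mul0r add0r mulrAC ler_pdivrMr.
    have qa : q 0 a = 0 * x 0 a + t * y 0 a by rewrite mul0r add0r divfK // gt_eqF.
    have qb : q 0 b = 0 * x 0 b + t * y 0 b.
      apply/eqP; rewrite eq_le le_q mul0r add0r mulrAC ler_pdivlMr // andbT.
      exact: bmin.
    rewrite (weight_repl2 (neq _ _ aA bB) (lt0r_neq0 (x0 a)) (D0 _ _ aA bB)
      (lexx 0) (ltW t0) le_q qa qb).
    by rewrite scale0r subr0 sE eqxx gt_eqF // addn0 addn1.
  apply: leq_trans (leq_add (leq_trans H1 (leq_addl _ _)) H2).
  have M0 : (0 < #|M|)%N by rewrite spl ltn_addr.
  have := pred_add_leq_mul M0 (_ : (0 < n - #|M|)%N); rewrite subn_gt0 => /(_ Mn).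
  rewrite subnKC ?(ltnW Mn) // => /leq_trans; apply.
  rewrite mulnA -mulnDl leq_mul2r; apply/orP; right; rewrite (spl M).
  by case: #|M :&: A| MA => // v _; nia.
have [s [r [a [b [[s0 r0] aA bB [qa qb] le_q]]]]] :=
  touching_point x0 y0 q0 A0 B0 AB xA yB.
pose f := q - s *: x - r *: y.
have fE j : f 0 j = q 0 j - s * x 0 j - r * y 0 j by rewrite !mxE.
pose Z := [set j | f 0 j == 0].
have sE : #|supp f| = (n - #|Z|)%N.
  rewrite cardsCs card_ord; congr (_ - #|pred_of_set _|)%N.
  by apply/setP=> j; rewrite !inE negbK.
have ZP j : j \in Z -> q 0 j = s * x 0 j + r * y 0 j.
  by rewrite inE fE => /eqP; lra.
have aZ : (0 < #|Z :&: A|)%N.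
  rewrite card_gt0; apply/set0Pn; exists a; rewrite !inE aA fE qa andbT.
  by apply/eqP; ring.
have bZ : (0 < #|Z :&: ~: A|)%N.
  rewrite card_gt0; apply/set0Pn; exists b; rewrite inE bB inE fE qb andbT.
  by apply/eqP; ring.
have H : (#|Z :&: A| * (#|Z :&: ~: A| * (n - #|Z|).+1) <=
      \sum_(a in A) \sum_(b in ~: A) weight (repl (repl 1%:M a x) b y) q)%N.
  apply: leq_sum2_const; [exact: subsetIr|exact: subsetIr|].
  move=> i j /setIP[iZ iA] /setIP[jZ jB].
  rewrite (weight_repl2 (neq _ _ iA jB) (lt0r_neq0 (x0 i)) (D0 _ _ iA jB)
    (ltW s0) (ltW r0) le_q (ZP _ iZ) (ZP _ jZ)).
  by rewrite -/f sE !gt_eqF // !addn1.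
apply: leq_trans (leq_trans H (leq_addl _ _)).
have Zn : (#|Z| <= n)%N by rewrite -[X in (_ <= X)%N]card_ord max_card.
have Z1 : (0 < #|Z|.-1)%N.
  rewrite (spl Z); case: #|Z :&: A| aZ => // u _.
  by case: #|_| bZ => // v _; rewrite addSn addnS.
have := pred_add_leq_mul Z1 (ltn0Sn (n - #|Z|)).
rewrite addnS -addSn prednK ?subnKC //; last exact: leq_trans Z1 (leq_pred _).
move=> /leq_trans; apply; rewrite mulnA leq_mul2r /= (spl Z).
exact: pred_add_leq_mul.
Qed.

End Cover.

(** * Cutting up a simplex of least volume *)

Section Tight.
Context (R : archiRealFieldType) (n : nat).
Implicit Types (x y q : 'rV[R]_n) (i j a b l : 'I_n) (A : {set 'I_n}).

(** Barycentric coordinates of the interior lattice points of a simplex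
    that has the least volume allowed by [cell_bound]. *)
Definition tight_configuration (lat : 'rV[R]_n -> Prop) (xs : seq 'rV[R]_n) :=
  [/\ barycentric_lattice (n.-1 * size xs).+1%:R lat, uniq xs,
      forall x, x \in xs -> lat x & forall x, x \in xs -> all_positive x].

Context (lat : 'rV[R]_n -> Prop) (xs : seq 'rV[R]_n).
Context (n1 : (1 < n)%N) (tight : tight_configuration lat xs).
Let N : R := (n.-1 * size xs).+1%:R.

Lemma tight_pos x : x \in xs -> all_positive x.
Proof. by case: tight => _ _ _; apply. Qed.

Lemma tight_lat x : x \in xs -> lat x.
Proof. by case: tight => _ _ + _; apply. Qed.

Lemma tight_mass x : x \in xs -> mass x = 1.
Proof. by case: tight => [[+ _ _] _ + _] => lat1 latx /latx /lat1. Qed.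

Lemma N_gt0 : 0 < N. Proof. by rewrite ltr0n. Qed.

Lemma lat_id i : lat (row i 1%:M).
Proof. by rewrite row1; case: tight => [[_ + _] _ _ _]; apply. Qed.

Lemma tight_neq_vertex x i : x \in xs -> x != row i 1%:M.
Proof.
move=> xxs; apply/eqP=> xE.
have [j] := @exists_notin n [:: i] n1; rewrite inE => ji.
by have := tight_pos xxs j; rewrite xE !mxE eq_sym (negbTE ji) ltxx.
Qed.

Lemma tight_cell W (Q : seq 'rV[R]_n) :
  (forall i, lat (row i W)) -> W \in unitmx -> uniq Q -> {subset Q <= xs} ->
  (forall q, q \in Q -> forall i, q != row i W) ->
  1 + (\sum_(q <- Q) weight W q)%:R <= N * `|\det W|.
Proof.
move=> latW uW uQ Qxs Qrow; case: tight => barN _ _ _.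
by apply: (cell_bound N_gt0 barN) => // q qQ; apply: tight_lat; apply: Qxs.
Qed.

Lemma star_cell x i (Q : seq 'rV[R]_n) :
  x \in xs -> uniq Q -> {subset Q <= xs} -> x \notin Q ->
  1 + (\sum_(q <- Q) weight (repl 1%:M i x) q)%:R <= N * x 0 i.
Proof.
move=> xxs uQ Qxs xQ; have xi : 0 < x 0 i := tight_pos xxs i.
have dW : \det (repl 1%:M i x) = x 0 i by rewrite det_repl1.
rewrite -[x 0 i]gtr0_norm // -dW; apply: tight_cell => //.
- move=> l; rewrite row_repl; case: (l == i); last exact: lat_id.
  exact: tight_lat.
- by rewrite unitmx_det dW gt_eqF.
- move=> q qQ l; rewrite row_repl.
  case: (l == i); last exact: tight_neq_vertex (Qxs _ qQ).
  by apply: contraNneq xQ => <-.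
Qed.

(** The cones from [x] over the facets have total volume [N], so equality
    holds for each of them once the lower bounds of [star_cell] add up to at
    least [N].  A point [q] with [M = lowest x q] contributes [#|M| * (n - #|M|)]
    to the sum of these bounds, which is at least [n.-1]. *)
Lemma star_volume x i : x \in xs ->
  N * x 0 i = 1 + (\sum_(q <- rem x xs)
     (if i \in lowest x q then n - #|lowest x q| else 0))%:R.
Proof.
move=> xxs; have x0 := tight_pos xxs.
have uxs : uniq xs by case: tight.
have rx q : q \in rem x xs = (q != x) && (q \in xs) by rewrite mem_rem_uniq // inE.
pose F i : R := 1 + (\sum_(q <- rem x xs)
     (if i \in lowest x q then n - #|lowest x q| else 0))%:R.
have leF j : F j <= N * x 0 j.
  have : 1 + (\sum_(q <- rem x xs) weight (repl 1%:M j x) q)%:R <= N * x 0 j.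
    apply: star_cell; rewrite ?rem_uniq ?mem_rem_uniqF //.
    by move=> q; rewrite rx => /andP[].
  apply: le_trans; rewrite lerD2l ler_nat big_seq [X in (_ <= X)%N]big_seq.
  apply: leq_sum => q; rewrite rx => /andP[_ qxs].
  case: ifP => // jM.
  by have [-> _] := weight_lowest x0 (tight_pos qxs) jM.
have sumF : N <= \sum_j F j.
  rewrite big_split /= sumr_const card_ord -natr_sum -natrD ler_nat.
  rewrite exchange_big /=.
  have sr : size (rem x xs) = (size xs).-1 by rewrite size_rem.
  have s0 : (0 < size xs)%N by case: (xs) xxs.
  suff : (size (rem x xs) * n.-1 <= \sum_(q <- rem x xs) \sum_j
     (if j \in lowest x q then n - #|lowest x q| else 0))%N.
    rewrite sr => le; apply: leq_trans (leq_add (leqnn n) le).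
    by case: (size xs) s0 => // m _; case: (n) n1 => // p _ /=; nia.
  rewrite -sum1_size big_distrl /= big_seq [X in (_ <= X)%N]big_seq.
  apply: leq_sum => q; rewrite rx mul1n => /andP[qx qxs].
  rewrite -big_mkcond sum_nat_const.
  have Mn : (#|lowest x q| < n)%N.
    by apply: lowest_neqT => //; [exact: tight_pos|exact: tight_mass|exact: tight_mass].
  have M0 : (0 < #|lowest x q|)%N by rewrite card_gt0; exact: (lowest_neq0 q i x0).
  have := pred_add_leq_mul M0 (_ : (0 < n - #|lowest x q|)%N).
  by rewrite subn_gt0 subnKC ?(ltnW Mn) //; apply.
have : \sum_j (N * x 0 j - F j) == 0.
  rewrite eq_le sumr_ge0 ?andbT => [|j _]; last by rewrite subr_ge0.
  by rewrite sumrB -mulr_sumr [\sum_i _](tight_mass xxs) mulr1 subr_le0.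
rewrite psumr_eq0 => [/allP/(_ i)|j _]; last by rewrite subr_ge0.
by rewrite mem_index_enum => /(_ isT); rewrite subr_eq0 => /eqP.
Qed.

(** The number of cells is [#|A| * #|~: A| + n], their volumes add up to [N],
    and by [pair_weight] each of the other [size xs - 2] points contributes at
    least [n.-1] to the sum of the bounds of [cell_bound].  Comparing with
    [N = n.-1 * size xs + 1] leaves this inequality. *)
Lemma split_card x y A : x \in xs -> y \in xs ->
  A != set0 -> ~: A != set0 ->
  (forall a b, a \in A -> b \in ~: A -> y 0 a * x 0 b < y 0 b * x 0 a) ->
  (#|A| * #|~: A| <= n.-1)%N.
Proof.
move=> xxs yxs A0 B0 AB; have x0 := tight_pos xxs; have y0 := tight_pos yxs.
have uxs : uniq xs by case: tight.
have xy : y != x.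
  have /set0Pn[a aA] := A0; have /set0Pn[b bB] := B0.
  by apply/eqP=> yx; have := AB a b aA bB; rewrite yx mulrC ltxx.
pose Q := rem y (rem x xs).
have yrem : y \in rem x xs by rewrite mem_rem_uniq // inE xy.
have Qin q : q \in Q = [&& q != y, q != x & q \in xs].
  by rewrite mem_rem_uniq ?rem_uniq // inE mem_rem_uniq // inE.
have uQ : uniq Q by rewrite !rem_uniq.
have Qxs : {subset Q <= xs} by move=> q; rewrite Qin => /and3P[].
have D0 a b : a \in A -> b \in ~: A -> 0 < x 0 a * y 0 b - x 0 b * y 0 a.
  by move=> aA bB; rewrite subr_gt0 mulrC [ltRHS]mulrC AB.
have neq a b : a \in A -> b \in ~: A -> a != b.
  by move=> aA; rewrite inE; apply: contraNneq => <-.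
have H1 b : b \in ~: A ->
    1 + (\sum_(q <- Q) weight (repl 1%:M b x) q)%:R <= N * x 0 b.
  by move=> _; apply: star_cell; rewrite ?Qin ?eqxx ?andbF.
have H2 a : a \in A ->
    1 + (\sum_(q <- Q) weight (repl 1%:M a y) q)%:R <= N * y 0 a.
  by move=> _; apply: star_cell; rewrite ?Qin ?eqxx.
have H3 a b : a \in A -> b \in ~: A ->
    1 + (\sum_(q <- Q) weight (repl (repl 1%:M a x) b y) q)%:R <=
    N * (x 0 a * y 0 b - x 0 b * y 0 a).
  move=> aA bB; have d0 := D0 a b aA bB.
  have dE := det_repl2 y (neq _ _ aA bB) (lt0r_neq0 (x0 a)).
  rewrite -[X in N * X]gtr0_norm // -dE; apply: tight_cell => //.
  - move=> l; rewrite !row_repl; case: (l == b); first exact: tight_lat.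
    by case: (l == a); [exact: tight_lat|exact: lat_id].
  - by rewrite unitmx_det dE gt_eqF.
  - move=> q; rewrite Qin => /and3P[qy qx qxs] l; rewrite !row_repl.
    by case: (l == b) => //; case: (l == a) => //; apply: tight_neq_vertex.
pose w1 b q := weight (repl 1%:M b x) q.
pose w2 a q := weight (repl 1%:M a y) q.
pose w3 a b q := weight (repl (repl 1%:M a x) b y) q.
(* The volumes of the three families of cells add up to N: with X and Y the
   masses of x and y on A, this is the identity
   (1 - X) + Y + X (1 - Y) - (1 - X) Y = 1. *)
have NE : N = \sum_(b in ~: A) N * x 0 b + \sum_(a in A) N * y 0 a +
    \sum_(a in A) \sum_(b in ~: A) N * (x 0 a * y 0 b - x 0 b * y 0 a).
  have mE z : z \in xs -> \sum_(b in ~: A) z 0 b = 1 - \sum_(a in A) z 0 a.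
    move=> zxs; rewrite -(tight_mass zxs) /mass.
    rewrite [in RHS](bigID (mem A)) /= addrAC subrr add0r.
    by apply: eq_bigl => b; rewrite inE.
  under [X in _ = _ + X]eq_bigr => a aA do rewrite -mulr_sumr sumrB -mulr_sumr -mulr_suml.
  rewrite -!mulr_sumr sumrB -mulr_suml -mulr_sumr !mE //.
  by ring.
have : (#|A| * #|~: A| + n)%:R + (\sum_(q <- Q) (\sum_(b in ~: A) w1 b q +
   \sum_(a in A) w2 a q + \sum_(a in A) \sum_(b in ~: A) w3 a b q))%:R <= N.
  rewrite [leRHS]NE.
  apply: le_trans (lerD (lerD (ler_sum _ H1) (ler_sum _ H2))
    (ler_sum _ (fun a aA => ler_sum _ (fun b bB => H3 a b aA bB)))).
  under [X in _ <= _ + X]eq_bigr => a aA do rewrite big_split /= -natr_sum sumr_const.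
  rewrite !big_split /= -!natr_sum sum_nat_const !sumr_const -!natrD ler_nat.
  have E1 : (\sum_(b in ~: A) \sum_(q <- Q) w1 b q =
      \sum_(q <- Q) \sum_(b in ~: A) w1 b q)%N by rewrite exchange_big.
  have E2 : (\sum_(a in A) \sum_(q <- Q) w2 a q =
      \sum_(q <- Q) \sum_(a in A) w2 a q)%N by rewrite exchange_big.
  have E3 : (\sum_(a in A) \sum_(b in ~: A) \sum_(q <- Q) w3 a b q =
      \sum_(q <- Q) \sum_(a in A) \sum_(b in ~: A) w3 a b q)%N.
    by rewrite [RHS]exchange_big; apply: eq_bigr => a _; rewrite exchange_big.
  have cA : (#|A| + #|~: A| = n)%N by rewrite cardsC card_ord.
  rewrite -E1 -E2 -E3 /w1 /w2 /w3.
  have arith u v S1 S2 S3 : (u + v = n ->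
    u * v + n + (S1 + S2 + S3) <= v + S1 + (u + S2) + (u * v + S3))%N by nia.
  exact: arith.
have sQ : (size Q).+2 = size xs.
  have s1 : (0 < size (rem x xs))%N by case: (rem x xs) yrem.
  rewrite /Q size_rem // prednK //; rewrite size_rem // in s1 *.
  by rewrite prednK //; case: (size xs) s1.
rewrite -natrD ler_nat => le.
have : (size Q * n.-1 <= \sum_(q <- Q) (\sum_(b in ~: A) w1 b q +
   \sum_(a in A) w2 a q + \sum_(a in A) \sum_(b in ~: A) w3 a b q))%N.
  rewrite -sum1_size big_distrl /= big_seq [X in (_ <= X)%N]big_seq.
  apply: leq_sum => q; rewrite Qin mul1n => /and3P[qy qx qxs].
  by apply: pair_weight => //; try exact: tight_mass; exact: tight_pos.
have arith u p m S : (1 < p -> u + p + S <= (p.-1 * m.+2).+1 -> m * p.-1 <= S ->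
  u <= p.-1)%N by case: p => // p _ /=; nia.
by rewrite -sQ in le; apply: arith n1 le.
Qed.

End Tight.

Lemma seq_argmin (R : realDomainType) (T : eqType) (f : T -> R) (s : seq T) x0 :
  x0 \in s -> exists2 x, x \in s & forall y, y \in s -> f x <= f y.
Proof.
elim: s x0 => // z s IH x0 _; case: s IH => [|w s] IH.
  by exists z; rewrite ?mem_head // => y; rewrite inE => /eqP ->.
have [x xs xmin] := IH w (mem_head _ _).
have [fzx|fxz] := leP (f z) (f x).
  exists z; rewrite ?mem_head // => y; rewrite inE => /predU1P[-> //|ys].
  exact: le_trans fzx (xmin _ ys).
exists x; first by rewrite inE xs orbT.
by move=> y; rewrite inE => /predU1P[->|/xmin //]; exact: ltW.
Qed.

Lemma mul_gt_pred_add u v p : (1 < u)%N -> (1 < v)%N -> (v + u = p)%N ->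
  (v * u <= p.-1)%N -> False.
Proof.
case: u => [//|[//|u]] _; case: v => [//|[//|v]] _ <-.
by rewrite !mulSn !mulnS; lia.
Qed.

(** The difference of the two sides is [(u - v) * d * (k - k')], up to
    sign. *)
Lemma cross_eq_nat (u v k k' d : nat) : (0 < d)%N ->
  ((v + d * k).+1 * (u + d * k').+1 = (v + d * k').+1 * (u + d * k).+1)%N ->
  u = v \/ k = k'.
Proof.
move=> d0 h; have : ((u%:Z - v%:Z) * (d%:Z * (k%:Z - k'%:Z)) = 0)%R by nia.
move/eqP; rewrite !mulf_eq0 !subr_eq0.
by move=> /or3P[/eqP[->]|/eqP|/eqP[->]]; [left|lia|right].
Qed.

(** The second equation makes [s.+1] a unit modulo [M], so the first one
    gives [p.+1 = 1] modulo [M]. *)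
Lemma eq0_of_unit_mod (p s b r c M : nat) : (p.+1 * s.+1 = s.+1 + b * M)%N ->
  (r.+1 * s.+1 = 1 + c * M)%N -> (p.+1 < M)%N -> p = 0%N.
Proof.
move=> h1 h2 pM; have h3 : (p + p * c * M = r.+1 * b * M)%N by nia.
have : (M %| p)%N by rewrite -(dvdn_addl _ (dvdn_mull (p * c) (dvdnn M))) h3 dvdn_mull.
by case: p pM {h1 h3} => // p /ltnW pM; rewrite gtnNdvd.
Qed.

Lemma eq_of_nat_shift (R : realDomainType) (u v : R) (b c : nat) :
  0 < u < 1 -> 0 < v < 1 -> u + b%:R = v + c%:R -> u = v.
Proof.
move=> /andP[u0 u1] /andP[v0 v1] uv.
suff bc : b = c by move: uv; rewrite bc => /addIr.
case: (ltngtP b c) => [lt|lt|//]; exfalso; move: lt; rewrite -(ler_nat R) -natr1; lra.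
Qed.

(** * Points nearest to a facet *)

Section Collinear.
Context (R : archiRealFieldType) (n : nat).
Implicit Types (x y q : 'rV[R]_n) (i j a b l m : 'I_n) (A : {set 'I_n}).
Context (lat : 'rV[R]_n -> Prop) (xs : seq 'rV[R]_n).
Context (n3 : (3 < n)%N) (tight : tight_configuration lat xs).
Let N : R := (n.-1 * size xs).+1%:R.
Let n1 : (1 < n)%N := ltnW (ltnW n3).
Let pos x (xxs : x \in xs) : all_positive x := tight_pos tight xxs.
Let mass1 x (xxs : x \in xs) : mass x = 1 := tight_mass tight xxs.
Let N0 : 0 < N. Proof. by rewrite ltr0n. Qed.

Definition ratio x q i : R := q 0 i / x 0 i.

Lemma ltr_ratio x q i j : all_positive x ->
  (ratio x q i < ratio x q j) = (q 0 i * x 0 j < q 0 j * x 0 i).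
Proof. by move=> x0; rewrite /ratio ltr_pdivrMr // mulrAC ltr_pdivlMr. Qed.

Lemma ler_ratio x q i j : all_positive x ->
  (ratio x q i <= ratio x q j) = (q 0 i * x 0 j <= q 0 j * x 0 i).
Proof. by move=> x0; rewrite /ratio ler_pdivrMr // mulrAC ler_pdivlMr. Qed.

Lemma lowest_ratioP x q i : all_positive x ->
  reflect (forall j, ratio x q i <= ratio x q j) (i \in lowest x q).
Proof.
move=> x0; apply: (iffP (lowestP _ _ _)) => imin j; have := imin j;
  by rewrite ler_ratio.
Qed.

(** Two positive integers that are both at least 2 have a product exceeding
    their sum minus 1, so [split_card] excludes that both sides have two
    elements. *)
Lemma ratio_no_two_two x y a1 a2 b1 b2 : x \in xs -> y \in xs ->
  a1 != a2 -> b1 != b2 ->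
  ratio x y a1 < ratio x y b1 -> ratio x y a1 < ratio x y b2 ->
  ratio x y a2 < ratio x y b1 -> ratio x y a2 < ratio x y b2 -> False.
Proof.
move=> xxs yxs a12 b12 h11 h12 h21 h22.
(* Cutting at this threshold puts both a's on one side and both b's on
   the other. *)
pose t := Num.max (ratio x y a1) (ratio x y a2).
pose A := [set i | ratio x y i <= t].
have a1A : a1 \in A by rewrite inE le_max lexx.
have a2A : a2 \in A by rewrite inE le_max lexx orbT.
have b1B : b1 \in ~: A by rewrite !inE -ltNge gt_max h11 h21.
have b2B : b2 \in ~: A by rewrite !inE -ltNge gt_max h12 h22.
have AB a b : a \in A -> b \in ~: A -> y 0 a * x 0 b < y 0 b * x 0 a.
  rewrite !inE -ltNge => aA bB; rewrite -ltr_ratio; last exact: pos.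
  exact: le_lt_trans aA bB.
have A0 : A != set0 by apply/set0Pn; exists a1.
have B0 : ~: A != set0 by apply/set0Pn; exists b1.
have := split_card n1 tight xxs yxs A0 B0 AB.
have two (C : {set 'I_n}) c d : c \in C -> d \in C -> c != d -> (1 < #|C|)%N.
  by move=> cC dC cd; apply/card_gt1P; exists c, d.
have := two _ _ _ a1A a2A a12; have := two _ _ _ b1B b2B b12.
by move=> u v; apply: mul_gt_pred_add u v _; rewrite cardsC card_ord.
Qed.

Lemma tight_nat q l : q \in xs -> exists p : nat, N * q 0 l = p.+1%:R.
Proof.
by move=> qxs; eexists; rewrite (star_volume n1 tight) // -natr1 addrC; congr (_ + _).
Qed.

Lemma tight_lt1 q l : q \in xs -> q 0 l < 1.
Proof.
move=> qxs; have [j] := @exists_notin n [:: l] n1; rewrite inE => jl.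
rewrite -(mass1 qxs) /mass (bigD1 l) //= ltrDl (bigD1 j) //=.
rewrite ltr_pwDl ?sumr_ge0 ?pos // => m _; exact/ltW/pos.
Qed.

Lemma mass_inj x q : mass x = 1 -> mass q = 1 ->
  (forall l, q 0 l <= x 0 l) -> q = x.
Proof.
move=> x1 q1 le; have : \sum_l (x 0 l - q 0 l) == 0.
  by rewrite sumrB [\sum_i _]x1 [\sum_i q 0 i]q1 subrr.
rewrite psumr_eq0 => [/allP eq|l _]; last by rewrite subr_ge0.
by apply/rowP=> l; apply/esym/eqP; rewrite -subr_eq0; apply: (implyP (eq l _)).
Qed.

(** By [star_volume] the numbers [N * x 0 i] are positive integers, so this
    is the smallest possible height over facet [i]. *)
Definition nearest x i := x \in xs /\ N * x 0 i = 1.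

(** If [x] has the least [i]-th coordinate among all points, no other point
    [q] lies in the cone from [x] over facet [i]: its ratio [q i / x i] would be at
    least 1 and yet the least one, whence [q = x] by comparing masses. *)
Lemma nearest_exists i : (0 < size xs)%N -> exists x, nearest x i.
Proof.
case E : xs => [//|z s] _; have zxs : z \in xs by rewrite E mem_head.
have [x xxs xmin] := seq_argmin (fun x => x 0 i) zxs.
exists x; split=> //; rewrite (star_volume n1 tight) // big_seq big1 ?addr0 // => q.
have uxs : uniq xs by case: tight.
rewrite mem_rem_uniq // inE => /andP[qx qxs]; case: ifP => // /lowestP imin.
suff : x = q by move=> xq; rewrite xq eqxx in qx.
apply: mass_inj; [exact: mass1|exact: mass1|move=> l].
have x0 := pos xxs; rewrite -(ler_pM2r (x0 i)); apply: le_trans (imin l).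
by rewrite mulrC ler_wpM2r ?xmin // ltW.
Qed.

(** The vertices of facet [i] and [x] span a cell of normalized volume 1,
    hence generate the lattice: the combination [N q_i x - q], whose [i]-th
    coordinate vanishes, has integral coordinates.  They exceed -1 because
    coordinates of [q] are less than 1. *)
Lemma nearest_multiple x i q l : nearest x i -> q \in xs ->
  exists b : nat, x 0 l * (N * q 0 i) = q 0 l + b%:R.
Proof.
move=> [xxs xi] qxs; have [->|li] := eqVneq l i.
  by exists 0%N; rewrite addr0 mulrA [x 0 i * N]mulrC xi mul1r.
have x0 := pos xxs; have q0 := pos qxs.
have : N * \det (repl (repl 1%:M i x) l q) \is a Num.int.
  case: (tight) => [[_ _ latZ] _ _ _]; apply: latZ => m; rewrite !row_repl.
  by do 2?[case: ifP => _; first exact: tight_lat tight _ _]; exact: lat_id tight _.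
rewrite (det_repl2 _ (_ : i != l) (lt0r_neq0 (x0 i))) 1?eq_sym // => dZ.
have dE : N * (x 0 i * q 0 l - x 0 l * q 0 i) = q 0 l - x 0 l * (N * q 0 i).
  by rewrite mulrBr [N * (x 0 i * _)]mulrA xi mul1r; ring.
rewrite dE in dZ.
have {}dZ : x 0 l * (N * q 0 i) - q 0 l \is a Num.int by rewrite -opprB rpredN.
(* A coordinate of this integral row exceeds -1, hence is natural. *)
have gtN1 : -1 < x 0 l * (N * q 0 i) - q 0 l.
  have := tight_lt1 l qxs; have : 0 < x 0 l * (N * q 0 i) by rewrite !mulr_gt0.
  by lra.
have : x 0 l * (N * q 0 i) - q 0 l \is a Num.nat.
  rewrite natrEint dZ /=; move/intrP: dZ gtN1 => [z ->].
  by rewrite -[-1]/((-1)%:~R) ltr_int ler0z; case: z => // -[].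
by move=> /natrP[b bE]; exists b; rewrite -bE addrC subrK.
Qed.

(** By [nearest_multiple], [q] is at most [(q i / x i) x] coordinatewise. *)
Lemma nearest_max x i q l : nearest x i -> q \in xs -> ratio x q l <= ratio x q i.
Proof.
move=> xi qxs; have [b bE] := nearest_multiple l xi qxs; have [xxs x1] := xi.
rewrite ler_ratio; last exact: pos.
have le : q 0 l <= x 0 l * (N * q 0 i) by rewrite bE lerDl ler0n.
apply: le_trans (ler_wpM2r (ltW (pos xxs i)) le) _.
have -> : x 0 l * (N * q 0 i) * x 0 i = q 0 i * x 0 l * (N * x 0 i) by ring.
by rewrite x1 mulr1.
Qed.

Lemma nearest_unique x q i : nearest x i -> nearest q i -> q = x.
Proof.
move=> xi [qxs q1]; have [xxs _] := xi.
apply: mass_inj; [exact: mass1|exact: mass1|move=> l].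
by have [b] := nearest_multiple l xi qxs; rewrite q1 mulr1 => ->; rewrite lerDl ler0n.
Qed.

Lemma ratio_neq x q : x \in xs -> q \in xs -> q != x ->
  exists l m, ratio x q l < ratio x q m.
Proof.
move=> xxs qxs qx; have x0 := pos xxs.
have [l lM] : exists l, l \notin lowest x q.
  apply/existsP; rewrite -negb_forall; apply/negP => /forallP all_l.
  have := lowest_neqT x0 (pos qxs) (mass1 xxs) (mass1 qxs) qx.
  by rewrite (eq_card (_ : _ =i 'I_n)) ?card_ord ?ltnn // => m; rewrite all_l.
have : exists m, ratio x q m < ratio x q l.
  apply/existsP; apply: contraR lM; rewrite negb_exists => /forallP all_m.
  by apply/lowest_ratioP=> // m; rewrite leNgt all_m.
by case=> m lt_m; exists m, l.
Qed.

(** As [ratio x q] is maximal at both [i] and [j], [ratio_no_two_two] leaves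
    at most one index [l] where it is smaller; so [q] is the multiple of [x] by
    the integer [N q_i], except at [l].  For [q != x] that integer is at least 2,
    and comparing masses off [l] gives [x l > 1/2].  At most one index satisfies
    this, so [l] does not depend on [q]. *)
Lemma collinear_of_common_nearest x i j : i != j -> nearest x i -> nearest x j ->
  exists l, forall q, q \in xs -> exists t, forall m, m != l -> q 0 m = t * x 0 m.
Proof.
move=> ij xi xj; have [xxs x1] := xi; have x0 := pos xxs.
have off q : q \in xs -> exists l, forall m, m != l -> ratio x q m = ratio x q i.
  move=> qxs; have /set0Pn[l lM] := lowest_neq0 q i x0.
  exists l => m ml; apply/eqP; rewrite eq_le nearest_max //= leNgt.
  apply/negP => lt_mi; have /lowest_ratioP lmin := lM.
  have eq_ij : ratio x q j = ratio x q i by apply/eqP; rewrite eq_le !nearest_max.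
  have lt_li := le_lt_trans (lmin x0 m) lt_mi.
  by apply: (@ratio_no_two_two x q l m i j); rewrite ?eq_ij // eq_sym.
have half q l : q \in xs -> q != x ->
    (forall m, m != l -> ratio x q m = ratio x q i) -> 1 < 2 * x 0 l.
  move=> qxs qx offl; have [p pE] := tight_nat i qxs.
  have rE : ratio x q i = p.+1%:R.
    rewrite /ratio -pE; apply: (mulIf (lt0r_neq0 (x0 i))).
    by rewrite divfK ?gt_eqF // mulrAC x1 mul1r.
  have qm m : m != l -> q 0 m = p.+1%:R * x 0 m.
    by move=> ml; rewrite -rE -(offl m ml) divfK // gt_eqF.
  have : p.+1%:R * (1 - x 0 l) = 1 - q 0 l.
    rewrite -[X in _ * (X - _)](mass1 xxs) -[X in _ = X - _](mass1 qxs) /mass.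
    rewrite (bigD1 l) //= [X in _ = X - _](bigD1 l) //=.
    rewrite addrAC subrr add0r addrAC subrr add0r mulr_sumr.
    by apply: eq_bigr => m ml; rewrite qm.
  have p0 : p != 0%N.
    apply/eqP=> pz; move: qx; apply/negP; rewrite negbK; apply/eqP.
    have nq : nearest q i by split=> //; rewrite pE pz.
    exact: nearest_unique nq.
  have : 2 <= p.+1%:R :> R by rewrite ler_nat ltnS lt0n.
  have := x0 l; have := pos qxs l; have := tight_lt1 l xxs.
  by move: (p.+1%:R : R) => c; nra.
have [l lP] : exists l, forall m, 1 < 2 * x 0 m -> m = l.
  case: (pickP (fun m => 1 < 2 * x 0 m)) => [l lx|none].
    exists l => m mx; apply/eqP/negPn/negP => ml.
    have := mass1 xxs; rewrite /mass (bigD1 l) //= (bigD1 m) //=.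
    have : 0 <= \sum_(k | (k != l) && (k != m)) x 0 k.
      by apply: sumr_ge0 => k _; exact: ltW.
    by move: (\sum_(_ | _) _) => s; lra.
  by exists i => m; rewrite none.
exists l => q qxs; have [->|qx] := eqVneq q x.
  by exists 1 => m _; rewrite mul1r.
have [l' offl] := off q qxs.
have l'E := lP _ (half q l' qxs qx offl).
exists (ratio x q i) => m; rewrite -l'E => ml.
by rewrite -(offl m ml) divfK // gt_eqF.
Qed.

Lemma ratio_sym x y l m : all_positive x -> all_positive y ->
  (ratio x y l <= ratio x y m) = (ratio y x m <= ratio y x l).
Proof. by move=> x0 y0; rewrite !ler_ratio // mulrC [X in _ <= X]mulrC. Qed.

(** The ratio [y / x] is largest at [i] and smallest at [j], so two different
    values elsewhere, at [k] and [k'], would put [k] and [j] below [k'] and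
    [i]. *)
Lemma ratio_const_off x y i j l m : nearest x i -> nearest y j -> i != j ->
  l != i -> l != j -> m != i -> m != j -> ratio x y l = ratio x y m.
Proof.
move=> xi yj ij li lj mi mj; have [xxs _] := xi; have [yxs _] := yj.
have x0 := pos xxs; have y0 := pos yxs.
have imax k : ratio x y k <= ratio x y i by apply: nearest_max.
have jmin k : ratio x y j <= ratio x y k by rewrite ratio_sym // nearest_max.
have no_lt k k' : k != j -> k' != i -> ratio x y k < ratio x y k' -> False.
  move=> kj k'i lt; apply: (@ratio_no_two_two x y k j k' i) => //.
  - exact: lt_le_trans lt (imax _).
  - exact: le_lt_trans (jmin _) lt.
  - exact: le_lt_trans (jmin k) (lt_le_trans lt (imax _)).
apply/eqP; rewrite eq_le !leNgt.
by apply/andP; split; apply/negP; apply: no_lt.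
Qed.

Lemma lowest_set1P x q l : all_positive x ->
  reflect (forall m, m != l -> ratio x q l < ratio x q m) (lowest x q == [set l]).
Proof.
move=> x0; apply: (iffP eqP) => [ME m ml|lt_l].
  have /lowest_ratioP lmin : l \in lowest x q by rewrite ME inE.
  rewrite lt_neqAle lmin // andbT; apply: contra ml => /eqP eq_lm.
  rewrite -in_set1 -ME; apply/lowest_ratioP => // k; rewrite -eq_lm; exact: lmin.
apply/setP=> m; rewrite in_set1; have [->|ml] := eqVneq m l.
  by apply/lowest_ratioP=> // k; have [->|/lt_l/ltW] := eqVneq k l.
apply/negP=> /lowest_ratioP mmin; have := lt_l m ml.
by rewrite ltNge mmin.
Qed.

(** Away from [i] and [j] the points [x] and [y] are proportional, so [l]
    remains lowest among these indices.  Index [j] is the highest one for [y], and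
    if [i] were not above [l], the pair [i], [l] would be below [j] and a fourth
    index. *)
Lemma lowest_set1_transfer x y i j l q : nearest x i -> nearest y j -> q \in xs ->
  i != j -> l != i -> l != j ->
  lowest x q == [set l] -> lowest y q == [set l].
Proof.
move=> xi yj qxs ij li lj; have [xxs _] := xi; have [yxs _] := yj.
have x0 := pos xxs; have y0 := pos yxs.
move=> /(lowest_set1P _ _ x0) xlt; apply/lowest_set1P=> //.
have rE k : ratio y q k = ratio x q k / ratio x y k.
  by rewrite /ratio; field; rewrite !gt_eqF.
have r0 k : 0 < ratio x y k by rewrite divr_gt0.
have lt_off m : m != l -> m != i -> m != j -> ratio y q l < ratio y q m.
  move=> ml mi mj; rewrite !rE (ratio_const_off xi yj ij li lj mi mj).
  by rewrite ltr_pM2r ?invr_gt0 // xlt.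
have [m] := @exists_notin n [:: i; j; l] n3.
rewrite !inE !negb_or => /and3P[mi mj ml]; have lt_m := lt_off m ml mi mj.
have lt_j : ratio y q l < ratio y q j by apply: lt_le_trans lt_m (nearest_max _ _ _).
move=> k kl; have [->//|kj] := eqVneq k j.
have [->|ki] := eqVneq k i; last exact: lt_off.
rewrite ltNge; apply/negP => le_il.
apply: (@ratio_no_two_two y q i l m j) => //; first by rewrite eq_sym.
- exact: le_lt_trans le_il lt_m.
- exact: le_lt_trans le_il lt_j.
Qed.

(** The number of points strictly inside the cone from [x] over facet
    [l]. *)
Definition in_cone x l := (\sum_(q <- xs) (lowest x q == [set l]))%N.
(** The number of points on the segment from [x] to vertex [i], [x]
    excluded. *)
Definition on_edge x i := (\sum_(q <- rem x xs) (lowest x q == ~: [set i]))%N.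

(** For [x] nearest to facet [i], a point [q] is highest at [i] relative to
    [x].  If it is lowest at [l] and at another index, then it is lowest at all
    indices except [i], by [ratio_no_two_two].  So in the count of
    [star_volume] only the weights [n.-1] (lowest at [l] alone) and 1 (lowest
    off [i]) occur; the number of points of the second kind does not depend
    on [l]. *)
Lemma nearest_volume x i l : nearest x i -> l != i ->
  N * x 0 l = (on_edge x i + n.-1 * in_cone x l).+1%:R.
Proof.
move=> xi li; have [xxs _] := xi; have x0 := pos xxs.
have uxs : uniq xs by case: tight.
rewrite (star_volume n1 tight) // -natr1 addrC; congr (_%:R + 1).
have -> : in_cone x l = (\sum_(q <- rem x xs) (lowest x q == [set l]))%N.
  rewrite /in_cone (big_rem x) //= (_ : (_ == [set l]) = false) ?add0n //.
  apply/negP => /eqP ME; have : i \in lowest x x by apply/lowestP=> j; rewrite mulrC.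
  by rewrite ME inE eq_sym (negbTE li).
rewrite big_distrr -big_split /= big_seq [RHS]big_seq; apply: eq_bigr => q.
rewrite mem_rem_uniq // inE => /andP[qx qxs]; set M := lowest x q.
have iM : i \notin M.
  apply/negP=> /lowest_ratioP imin; have [k [m lt_km]] := ratio_neq xxs qxs qx.
  have := lt_le_trans lt_km (nearest_max m xi qxs).
  by rewrite ltNge imin.
have c1 : #|~: [set i]| = n.-1 by rewrite cardsC1 card_ord.
have notin_neq (S : {set 'I_n}) : l \notin M -> l \in S -> (M == S) = false.
  by move=> lM lS; apply/negP => /eqP ME; rewrite ME lS in lM.
have [lM|lM] := boolP (l \in M); last first.
  have -> : (M == [set l]) = false by apply: notin_neq => //; rewrite !inE.
  have -> : (M == ~: [set i]) = false by apply: notin_neq => //; rewrite !inE.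
  by rewrite muln0.
have [ME|Ml] := eqVneq M [set l].
  have -> : (M == ~: [set i]) = false.
    apply/negP => /eqP SE; have := c1; rewrite -SE ME cards1.
    by case: (n) n3 => // -[|[]].
  by rewrite ME cards1 muln1 subn1.
suff -> : M = ~: [set i].
  by rewrite eqxx /= muln0 addn0 c1 -{1}(prednK (ltnW n1)) subSnn.
have [m mM ml] : exists2 m, m \in M & m != l.
  apply/exists_inP; apply: contraR Ml; rewrite negb_exists_in => /forall_inP all_l.
  rewrite eqEsubset sub1set lM andbT; apply/subsetP=> m /all_l.
  by rewrite negbK inE.
apply/setP=> k; rewrite in_setC in_set1.
have [->|ki] := eqVneq k i; first exact: negbTE.
apply/negPn/negP => kM.
have lt_k c : c \in M -> ratio x q c < ratio x q k.
  move=> /lowest_ratioP cmin; rewrite lt_neqAle cmin // andbT.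
  apply: contra kM => /eqP eq_ck; apply/lowest_ratioP=> // d; rewrite -eq_ck; exact: cmin.
by apply: (@ratio_no_two_two x q l m k i); rewrite // 1?eq_sym //;
  try exact: lt_le_trans (lt_k _ _) (nearest_max _ _ _); exact: lt_k.
Qed.

(** By [nearest_multiple] the [l]-th coordinate determines all others modulo
    integers, and they lie strictly between 0 and 1. *)
Lemma nearest_eq_of_coord x y z l : nearest z l -> x \in xs -> y \in xs ->
  x 0 l = y 0 l -> x = y.
Proof.
move=> zl xxs yxs xyl; apply/rowP=> m.
have [b bE] := nearest_multiple m zl xxs; have [c cE] := nearest_multiple m zl yxs.
have eq_bc : x 0 m + b%:R = y 0 m + c%:R by rewrite -bE -cE xyl.
by apply: eq_of_nat_shift eq_bc; rewrite ?pos ?tight_lt1.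
Qed.

(** Put [s = N x_l = N x_m].  Since [x] is nearest to facet [i], the relation
    of [nearest_multiple] at [i] makes [s] a unit modulo [N]; the relation at [m]
    then reads [N z_m * s = s] modulo [N], so [N z_m = 1]. *)
Lemma nearest_of_equal_coords x z l m : nearest z l -> x \in xs ->
  (exists i, nearest x i) -> x 0 l = x 0 m -> nearest z m.
Proof.
move=> zl xxs [i xi] xlm; have [zxs _] := zl; have [_ xi1] := xi.
split=> //.
have [b bE] := nearest_multiple m zl xxs; have [c cE] := nearest_multiple i zl xxs.
have [p pE] := tight_nat m zxs; have [r rE] := tight_nat i zxs.
have [s sE] := tight_nat l xxs.
have sE' : N * x 0 m = s.+1%:R by rewrite -xlm.
have H1 : (p.+1 * s.+1 = s.+1 + b * (n.-1 * size xs).+1)%N.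
  apply/eqP; rewrite -(eqr_nat R) natrM natrD natrM -/N -pE -{2}sE' -sE.
  by rewrite -mulrA bE mulrDr [b%:R * N]mulrC.
have H2 : (r.+1 * s.+1 = 1 + c * (n.-1 * size xs).+1)%N.
  apply/eqP; rewrite -(eqr_nat R) natrM natrD natrM -/N -rE -sE.
  by rewrite -mulrA cE mulrDr xi1 [c%:R * N]mulrC.
have pN : (p.+1 < (n.-1 * size xs).+1)%N.
  rewrite -(ltr_nat R) -pE -/N -[ltRHS]mulr1 ltr_pM2l //; exact: tight_lt1.
by rewrite pE (eq0_of_unit_mod H1 H2 pN).
Qed.

(** Suppose that the nearest points are pairwise distinct.  Take four indices
    [i], [j], [l], [m].  The coordinates at [l] and [m] of the points nearest to [i]
    and [j] are given by [nearest_volume], where [in_cone] takes the same values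
    [k] and [k'] for both points, by [lowest_set1_transfer]; with [u] and [v] the two
    values of [on_edge], [ratio_const_off] yields
    [(v + d k + 1) (u + d k' + 1) = (v + d k' + 1) (u + d k + 1)], hence [u = v] or
    [k = k'].  In the first case the points nearest to [i] and [j] have the same
    [l]-th coordinate, so they coincide.  In the second case the point nearest to
    [i] has equal coordinates at [l] and [m], so the points nearest to [l] and [m]
    coincide. *)
Lemma common_nearest : (0 < size xs)%N ->
  exists x i j, [/\ i != j, nearest x i & nearest x j].
Proof.
move=> s0; have /fin_all_exists[pt ptP] : forall i, exists x, nearest x i.
  by move=> i; apply: nearest_exists.
have [/existsP[i /existsP[j /andP[ij /eqP eq_ij]]]|noeq] :=
    boolP [exists i, exists j, (i != j) && (pt i == pt j)].
  by exists (pt i), i, j; split=> //; rewrite eq_ij.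
have pt_neq i j : i != j -> pt i <> pt j.
  move=> ij eq_ij; move/negP: noeq; apply; apply/existsP; exists i.
  by apply/existsP; exists j; rewrite ij eq_ij /=.
have ptxs i : pt i \in xs by case: (ptP i).
pose o (k : nat) (k4 : (k < 4)%N) : 'I_n := Ordinal (leq_trans k4 n3).
pose i := @o 0 isT; pose j := @o 1 isT; pose l := @o 2 isT; pose m := @o 3 isT.
have in_coneE k : k != i -> k != j -> in_cone (pt i) k = in_cone (pt j) k.
  move=> ki kj; apply: eq_big_seq => q qxs; congr nat_of_bool.
  by apply/idP/idP; [apply: (lowest_set1_transfer (ptP i) (ptP j))
    |apply: (lowest_set1_transfer (ptP j) (ptP i))].
have vol k : k != i -> k != j ->
    N * pt i 0 k = (on_edge (pt i) i + n.-1 * in_cone (pt i) k).+1%:R /\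
    N * pt j 0 k = (on_edge (pt j) j + n.-1 * in_cone (pt i) k).+1%:R.
  move=> ki kj; rewrite (nearest_volume (ptP i) ki) (nearest_volume (ptP j) kj).
  by rewrite in_coneE.
have [il jl] := vol l isT isT; have [im jm] := vol m isT isT.
move: il jl im jm; set u := on_edge _ _; set v := on_edge _ _.
set k := in_cone _ _; set k' := in_cone _ _ => il jl im jm.
have : ratio (pt i) (pt j) l = ratio (pt i) (pt j) m.
  exact: (ratio_const_off (ptP i) (ptP j)).
have x0 := pos (ptxs i).
rewrite /ratio => /eqP.
rewrite (eqr_div _ _ (lt0r_neq0 (x0 l)) (lt0r_neq0 (x0 m))) => /eqP cross.
have : (v + n.-1 * k).+1%:R * (u + n.-1 * k').+1%:R =
       (v + n.-1 * k').+1%:R * (u + n.-1 * k).+1%:R :> R.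
  rewrite -il -jl -im -jm; transitivity (N * N * (pt j 0 l * pt i 0 m)); first by ring.
  by rewrite cross; ring.
rewrite -!natrM => /eqP; rewrite eqr_nat => /eqP cross_nat.
have d0 : (0 < n.-1)%N by rewrite -ltnS (ltn_predK n1).
have [uv|kk] := cross_eq_nat d0 (esym cross_nat).
- case: (pt_neq i j isT); apply: (nearest_eq_of_coord (ptP l)) => //.
  by apply: (mulfI (lt0r_neq0 N0)); rewrite il jl uv.
- case: (pt_neq l m isT); apply: (@nearest_unique _ _ m); first exact: ptP.
  apply: (nearest_of_equal_coords (ptP l) (ptxs i)); first by exists i; exact: ptP.
  by apply: (mulfI (lt0r_neq0 N0)); rewrite il im kk.
Qed.

Lemma tight_collinear : (0 < size xs)%N ->
  exists x l, x \in xs /\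
   forall q, q \in xs -> exists t, forall m, m != l -> q 0 m = t * x 0 m.
Proof.
move=> /common_nearest[x [i [j [ij xi xj]]]]; exists x.
have [l lP] := collinear_of_common_nearest ij xi xj.
by exists l; split=> //; case: xi.
Qed.

End Collinear.

(** * Lebesgue measure on tuples *)

From mathcomp Require Import finmap measurable_realfun.
From mathcomp Require Import all_classical all_reals all_analysis.
Import numFieldNormedType.Exports.
Local Open Scope classical_set_scope.
Local Open Scope ring_scope.

Lemma product_sigma_finite (R : realType) d1 d2
    (T1 : measurableType d1) (T2 : measurableType d2)
    (m1 : {sigma_finite_measure set T1 -> \bar R})
    (m2 : {sigma_finite_measure set T2 -> \bar R}) :
  sigma_finite setT (m1 \x m2)%E.
Proof.
have /sigma_finiteP[F [FT ndF mF]] := sigma_finiteT m1.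
have /sigma_finiteP[G [GT ndG mG]] := sigma_finiteT m2.
exists (fun i => F i `*` G i); last first.
  move=> i; have [? ?] := mF i; have [? ?] := mG i; split; first exact: measurableX.
  by rewrite product_measure1E // lte_mul_pinfty // ge0_fin_numE.
apply/esym; rewrite -subTset => -[x y] _.
have [i _ Fx] : (\bigcup_i F i) x by rewrite -FT.
have [j _ Gy] : (\bigcup_i G i) y by rewrite -GT.
exists (maxn i j) => //; split.
  by move: x Fx; apply/subsetPset/ndF/leq_maxl.
by move: y Gy; apply/subsetPset/ndG/leq_maxr.
Qed.

(** Packs the pushforward with its measurability and finiteness facts into an
    object of which products can be formed. *)
Lemma pushforward_sigma_finite (R : realType) d1 d2
    (T1 : measurableType d1) (T2 : measurableType d2)
    (m : {measure set T1 -> \bar R}) (f : T1 -> T2) :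
  measurable_fun setT f -> sigma_finite setT (pushforward m f) ->
  exists nu : {sigma_finite_measure set T2 -> \bar R},
    forall A, nu A = pushforward m f A.
Proof.
move=> mf sf.
pose nu := HB.pack_for {sigma_finite_measure set T2 -> \bar R} (pushforward m f)
  (Measure_isSigmaFinite.Build _ _ _ (pushforward m f) sf).
by exists (nu mf mf mf).
Qed.

Section TupleMeasure.
Context (R : realType).
Local Notation mR := (measurableTypeR R).
Local Notation mu := (@lebesgue_measure R).

Definition tcons n (p : mR * n.-tuple mR) : n.+1.-tuple mR := [tuple of p.1 :: p.2].

Lemma measurable_tcons n : measurable_fun setT (@tcons n).
Proof. exact: measurable_cons measurable_fst measurable_snd. Qed.

Definition tuncons n (t : n.+1.-tuple mR) : mR * n.-tuple mR :=
  (thead t, [tuple of behead t]).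

Lemma measurable_tuncons n : measurable_fun setT (@tuncons n).
Proof.
apply: measurable_fun_pair; last exact: measurable_behead.
exact: (measurable_tnth ord0).
Qed.

Lemma tconsK n : cancel (@tcons n) (@tuncons n).
Proof. by case=> x t; congr pair; rewrite ?theadE //; apply: val_inj. Qed.

(** Tonelli's theorem needs a sigma-finite measure, whereas [lebesgue_tuple]
    is only a set function.  The pushforward by the measurable bijection
    [tcons] inherits an exhausting sequence by pulling it back along
    [tuncons]. *)
Lemma lebesgue_tuple_measure n :
  exists m : {sigma_finite_measure set (n.-tuple mR) -> \bar R},
    forall A, m A = lebesgue_tuple A.
Proof.
elim: n => [|n [m mE]].
  by exists [the {sigma_finite_measure set _ -> \bar R} of \d_([tuple] : 0.-tuple mR)].
have mc := @measurable_tcons n.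
have [F FT Ffin] := product_sigma_finite mu m.
pose P := (mu \x m)%E.
pose nu := pushforward P (@tcons n).
have sf : sigma_finite [set: n.+1.-tuple mR] nu.
  exists (fun i => @tuncons n @^-1` F i).
    by rewrite -preimage_bigcup -FT preimage_setT.
  move=> i; have [mF Fi] := Ffin i; split.
    by rewrite -[X in measurable X]setTI; apply: measurable_tuncons.
  rewrite /nu /pushforward -comp_preimage.
  by rewrite (_ : _ \o _ = id) ?preimage_id //; apply/funext=> p; exact: tconsK.
have [nu2 nu2E] := @pushforward_sigma_finite _ _ _ _ _
  [the {measure set _ -> \bar R} of (mu \x m)%E] (@tcons n) mc sf.
exists nu2 => A; rewrite nu2E.
rewrite /= /nu /pushforward /P /= /product_measure1; apply: eq_integral => x _ /=.
by rewrite mE.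
Qed.
End TupleMeasure.

(** * Volume by iterated integration *)

Section RowVolume.
Context (R : realType).
Local Notation mR := (measurableTypeR R).
Local Notation mu := (@lebesgue_measure R).

Definition tuple_row n (t : n.-tuple mR) : 'rV[R]_n := \row_i tnth t i.

Definition row_measurable n (A : set 'rV[R]_n) : Prop :=
  measurable (@tuple_row n @^-1` A).

Lemma row_measurable_affine n m (M : 'M[R]_(n, m)) (w : 'rV[R]_m) A :
  row_measurable A -> row_measurable [set x : 'rV[R]_n | A (x *m M + w)].
Proof.
move=> mA; pose phi t := [tuple (tuple_row t *m M + w) 0 i | i < m] : m.-tuple mR.
have phiE t : tuple_row (phi t) = tuple_row t *m M + w.
  by apply/rowP=> i; rewrite [LHS]mxE tnth_mktuple.
have mphi : measurable_fun setT phi.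
  apply/measurable_fun_tnthP => i.
  rewrite (_ : _ \o _ = fun t => \sum_j tnth t j * M j i + w 0 i); last first.
    apply/funext=> t /=; rewrite tnth_mktuple mxE mxE; congr (_ + _).
    by apply: eq_bigr => j _; rewrite mxE.
  apply: measurable_funD => //; apply: measurable_sum => j.
  apply: measurable_funM => //; exact: measurable_tnth.
have phiA : @tuple_row n @^-1` [set x : 'rV[R]_n | A (x *m M + w)] =
    phi @^-1` (@tuple_row m @^-1` A).
  by apply/seteqP; split => t /=; rewrite phiE.
by rewrite /row_measurable phiA -[X in measurable X]setTI; apply: mphi.
Qed.

Lemma tuple_row_cons n (x : mR) (t : n.-tuple mR) :
  tuple_row (tcons (x, t)) = row_mx (x%:M : 'M[R]_1) (tuple_row t) :> 'rV[R]_(1 + n).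
Proof.
apply/rowP=> i; rewrite mxE; case: (splitP i) => j ij.
  rewrite (_ : i = lshift n j) ?row_mxEl; last exact: val_inj.
  rewrite [j]ord1 mxE mulr1n (_ : lshift n 0 = ord0) ?tnth0 //; exact: val_inj.
rewrite (_ : i = rshift 1 j) ?row_mxEr; last exact: val_inj.
rewrite mxE (_ : rshift 1 j = lift ord0 j); last exact: val_inj.
exact: tnthS.
Qed.

(** The section over a first coordinate, which is integrated last. *)
Definition slice n (A : set 'rV[R]_(1 + n)) (x : R) : set 'rV[R]_n :=
  [set r | A (row_mx x%:M r)].

Lemma Vol_slice n (A : set 'rV[R]_(1 + n)) :
  Vol A = (\int[mu]_x Vol (slice A x))%E.
Proof.
rewrite /Vol /= /pushforward /product_measure1; apply: eq_integral => x _ /=.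
congr lebesgue_tuple; apply/seteqP; split=> t /=; rewrite /xsection /= inE /=;
  by rewrite -[X in A X]/(tuple_row (tcons (x, t))) tuple_row_cons.
Qed.

Lemma measurable_cons_preimage n (A : set 'rV[R]_(1 + n)) : row_measurable A ->
  measurable (@tcons R n @^-1` (@tuple_row (1 + n) @^-1` A)).
Proof. by move=> mA; rewrite -[X in measurable X]setTI; apply: measurable_tcons. Qed.

Lemma measurable_Vol_slice n (A : set 'rV[R]_(1 + n)) :
  row_measurable A -> measurable_fun setT (fun x : mR => Vol (slice A x)).
Proof.
move=> /measurable_cons_preimage mA; have [m mE] := lebesgue_tuple_measure R n.
have := measurable_fun_xsection m mA.
congr measurable_fun; apply/funext=> x /=; rewrite mE /Vol.
congr lebesgue_tuple; apply/seteqP; split=> t /=; rewrite /xsection /= inE /=;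
  by rewrite -[X in A X]/(tuple_row (tcons (x, t))) tuple_row_cons.
Qed.

Lemma Vol_ge0 n (A : set 'rV[R]_n) : row_measurable A -> (0 <= Vol A)%E.
Proof.
by move=> mA; have [m mE] := lebesgue_tuple_measure R n; rewrite /Vol -mE measure_ge0.
Qed.

(** The section over the remaining coordinates, on which the first one
    varies. *)
Definition fiber n (A : set 'rV[R]_(1 + n)) (r : 'rV[R]_n) : set mR :=
  [set x | A (row_mx x%:M r)].

(** Tonelli's theorem: the first coordinate may be integrated first.  The
    same measure [m] serves all [A], so that integrals over different sets can
    be compared under one integral sign. *)
Lemma Vol_fiber n : exists m : {measure set (n.-tuple mR) -> \bar R},
  forall A : set 'rV[R]_(1 + n), row_measurable A ->
  [/\ Vol A = (\int[m]_t mu (fiber A (tuple_row t)))%E,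
      measurable_fun setT (fun t : n.-tuple mR => mu (fiber A (tuple_row t))) &
      forall t, measurable (fiber A (tuple_row t))].
Proof.
have [m mE] := lebesgue_tuple_measure R n; exists m => A mA.
have mB := measurable_cons_preimage mA; set B := (X in measurable X) in mB.
have fE t : fiber A (tuple_row t) = ysection B t.
  by apply/seteqP; split=> x; rewrite /ysection /= inE /B /fiber /= tuple_row_cons.
split.
- transitivity ((mu \x m)%E B).
    rewrite Vol_slice; apply: eq_integral => x _ /=; rewrite mE /Vol.
    congr lebesgue_tuple; apply/seteqP; split=> t /=; rewrite /xsection /= inE /B /=;
    by rewrite -[X in A X]/(tuple_row (tcons (x, t))) tuple_row_cons.
  rewrite (product_measure_unique
    (m' := [the {measure set _ -> \bar R} of (mu \x^ m)%E])) //.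
    by apply: eq_integral => t _; rewrite fE.
  by move=> C D mC mD; rewrite /= product_measure2E.
- rewrite (_ : (fun t => _) = (mu \o ysection B)); first exact: measurable_fun_ysection.
  by apply/funext=> t /=; rewrite fE.
- by move=> t; rewrite fE; apply: measurable_ysection.
Qed.

End RowVolume.

(** * Volume under affine maps *)

Section AffineChange.
Context (R : realType).
Local Notation mR := (measurableTypeR R).
Local Notation mu := (@lebesgue_measure R).

(** The measure [A |-> |a| * mu (T^-1 A)], with [T] the affine map, agrees
    with [mu] on intervals, hence everywhere. *)
Lemma lebesgue_measure_affine (a b : R) (A : set mR) : a != 0 -> measurable A ->
  mu [set x : mR | A (x * a + b)] = (`|a|^-1%:E * mu A)%E.
Proof.
move=> a0 mA; pose phi (x : mR) : mR := x * a + b.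
have mphi : measurable_fun setT phi.
  by apply: measurable_funD => //; apply: measurable_funM.
pose push := [the {measure set mR -> \bar R} of pushforward mu phi].
pose nu := [the {measure set mR -> \bar R} of
  mscale (NngNum (normr_ge0 a)) (push mphi)].
suff : mu A = nu A.
  move=> ->; rewrite /nu /= /mscale /= muleA -EFinM mulVf ?normr_eq0 // mul1e.
  by [].
apply: lebesgue_measure_unique => //= _ [[u v] /= _ <-].
rewrite /mscale /= /pushforward.
have [a_gt0|a_lt0|/esym a_eq0] := ltgtP 0 a; last by rewrite a_eq0 eqxx in a0.
- have -> : phi @^-1` `]u, v] = `](u - b) / a, (v - b) / a]%classic.
    apply/seteqP; split=> x /=; rewrite !in_itv /= ltr_pdivrMr // ler_pdivlMr //;
    by rewrite ltrBlDr lerBrDr.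
  rewrite !lebesgue_measure_itv /= !lte_fin ltr_pM2r ?invr_gt0 // ltrD2r.
  case: ifP => // _; last by rewrite mule0.
  by rewrite -!EFinB -EFinM gtr0_norm //; congr EFin; field.
- have -> : phi @^-1` `]u, v] = `[(v - b) / a, (u - b) / a[%classic.
    apply/seteqP; split=> x /=; rewrite !in_itv /= ler_ndivrMr // ltr_ndivlMr //;
    by rewrite lerBrDr ltrBlDr andbC.
  rewrite !lebesgue_measure_itv /= !lte_fin ltr_nM2r ?invr_lt0 // ltrD2r.
  case: ifP => // _; last by rewrite mule0.
  by rewrite -!EFinB -EFinM ltr0_norm //; congr EFin; field.
Qed.

(** In terms of preimages, for which composition is immediate. *)
Definition scales n (T : 'rV[R]_n -> 'rV[R]_n) (k : R) : Prop :=
  forall A, row_measurable A ->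
    row_measurable (T @^-1` A) /\ Vol (T @^-1` A) = (k%:E * Vol A)%E.

Lemma scales_comp n (T T' : 'rV[R]_n -> 'rV[R]_n) k k' :
  scales T k -> scales T' k' -> scales (T' \o T) (k * k').
Proof.
move=> sT sT' A mA; have [mA' VA'] := sT' A mA; have [mA'' VA''] := sT _ mA'.
by split=> //; rewrite comp_preimage VA'' VA' muleA EFinM.
Qed.

Lemma row_measurable_slice n (A : set 'rV[R]_(1 + n)) x :
  row_measurable A -> row_measurable (slice A x).
Proof.
move=> /measurable_cons_preimage mA; have := measurable_xsection x mA.
congr measurable; apply/seteqP; split=> t;
  by rewrite /xsection /= inE /= tuple_row_cons.
Qed.

(** Only the first coordinate changes, by an affine map of the line whose
    constant term depends on the other coordinates; it is integrated first. *)
Lemma scales_first n (a : R) (b : 'cV[R]_n) (w : R) : a != 0 ->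
  scales (fun z : 'rV[R]_(1 + n) =>
    z *m block_mx a%:M 0 b 1%:M + row_mx w%:M 0) `|a|^-1.
Proof.
move=> a0 A mA; set T := (fun z => _).
have mTA : row_measurable (T @^-1` A) by apply: row_measurable_affine.
split=> //; have [m mE] := Vol_fiber R n.
have [-> _ _] := mE _ mTA; have [-> mf mfib] := mE _ mA.
rewrite -ge0_integralZl ?lee_fin ?invr_ge0 //.
apply: eq_integral => t _; set s := (tuple_row t *m b) 0 0.
have tbE : tuple_row t *m b = s%:M by exact: mx11_scalar.
rewrite -(lebesgue_measure_affine (s + w)) //.
have TE x : T (row_mx x%:M (tuple_row t)) = row_mx (x * a + (s + w))%:M (tuple_row t).
  rewrite /T mul_row_block add_row_mx tbE mulmx0 mulmx1 add0r addr0 -scalar_mxM.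
  by rewrite -!raddfD /= addrA.
by congr mu; apply/seteqP; split=> x; rewrite /fiber /= TE.
Qed.

(** The first coordinate is fixed, and on each slice the map is affine with
    linear part [D]; the first coordinate is integrated last. *)
Lemma scales_rest n (c : 'rV[R]_n) (D : 'M[R]_n) (w : 'rV[R]_n) k : 0 <= k ->
  (forall v, scales (fun r => r *m D + v) k) ->
  scales (fun z : 'rV[R]_(1 + n) =>
    z *m block_mx 1%:M c 0 D + row_mx 0 w) k.
Proof.
move=> k0 sD A mA; set T := (fun z => _).
have mTA : row_measurable (T @^-1` A) by apply: row_measurable_affine.
have mV := measurable_Vol_slice mA.
have V0 (x : mR) : setT x -> (0 <= Vol (slice A x))%E.
  by move=> _; apply: Vol_ge0; apply: row_measurable_slice mA.
split=> //; rewrite !Vol_slice -ge0_integralZl ?lee_fin //.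
apply: eq_integral => x _.
have [_ <-] := sD (x *: c + w) _ (row_measurable_slice x mA).
have TE r : T (row_mx x%:M r) = row_mx x%:M (r *m D + (x *: c + w)).
  rewrite /T mul_row_block add_row_mx mulmx1 mulmx0 !addr0 mul_scalar_mx.
  by rewrite addrA [_ + r *m D]addrC.
by congr (Vol _); apply/seteqP; split=> r; rewrite /slice /= TE.
Qed.

(** Induction on the dimension.  If the upper left entry is nonzero,
    elimination factors [M] into a map of the first coordinate ([scales_first])
    and a map of the others ([scales_rest]).  Otherwise a shear, which preserves
    volume, makes that entry nonzero. *)
Lemma scales_affine n (M : 'M[R]_n) (w : 'rV[R]_n) : M \in unitmx ->
  scales (fun x => x *m M + w) `|\det M|^-1.
Proof.
elim: n M w => [|n IH] M w uM.
  have -> : (fun x => x *m M + w) = id.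
    by apply/funext=> x; rewrite [RHS]thinmx0 [LHS]thinmx0.
  by move=> A mA; rewrite det_mx00 normr1 invr1 mul1e preimage_id.
have scales_pivot (M' : 'M[R]_(1 + n)) (w' : 'rV[R]_(1 + n)) :
    M' \in unitmx -> M' 0 0 != 0 -> scales (fun x => x *m M' + w') `|\det M'|^-1.
  move=> uM' a0; pose a := M' 0 0; pose b := dlsubmx M'.
  pose c := a^-1 *: ursubmx M'; pose D := drsubmx M' - b *m c.
  have ulE : ulsubmx M' = a%:M.
    by rewrite [LHS]mx11_scalar !mxE; congr (M' _ _)%:M; apply: val_inj.
  have ME : M' = block_mx a%:M 0 b 1%:M *m block_mx 1%:M c 0 D.
    rewrite mulmx_block !mulmx0 !mul0mx !mulmx1 !mul1mx !addr0 mul_scalar_mx.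
    by rewrite scalerA mulfV // scale1r addrC subrK -ulE submxK.
  have detE : \det M' = a * \det D.
    by rewrite ME det_mulmx det_lblock det_ublock !det1 mulr1 mul1r det_scalar1.
  have uD : D \in unitmx.
    rewrite unitmxE unitfE; move: uM'; rewrite unitmxE unitfE detE mulf_eq0.
    by rewrite negb_or => /andP[].
  have := scales_comp (@scales_first n a b (lsubmx w' 0 0) a0)
    (@scales_rest n c D (rsubmx w' - lsubmx w' 0 0 *: c) _ _ (fun v => IH D v uD)).
  rewrite -invfM -normrM -detE invr_ge0 normr_ge0 => /(_ isT).
  congr scales; apply/funext=> x /=.
  rewrite mulmxDl -mulmxA -ME -addrA; congr (_ + _).
  rewrite mul_row_block add_row_mx mulmx1 !mulmx0 mul0mx !addr0 mul_scalar_mx.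
  by rewrite addrC subrK -mx11_scalar hsubmxK.
have [a0|a0] := eqVneq (M 0 0) 0; last exact: (scales_pivot M w).
have [j Mj] : exists j : 'I_n, M (rshift 1 j : 'I_(1 + n)) 0 != 0.
  apply/existsP; apply: contraT; rewrite negb_exists => /forallP M0.
  move: uM; rewrite unitmxE unitfE (expand_det_col _ 0) big1 ?eqxx // => i _.
  suff -> : M i 0 = 0 by rewrite mul0r.
  case: (@splitP 1 n i) => l il.
    by rewrite -[RHS]a0; congr (M _ _); apply: val_inj; rewrite /= il [l]ord1.
  rewrite (_ : i = rshift 1 l); last exact: val_inj.
  by apply/eqP; have := M0 l; rewrite negbK.
(* Multiplying by E s on the left adds s times row j + 1 to the first row. *)
pose E (s : R) : 'M[R]_(1 + n) := block_mx 1%:M (s *: delta_mx 0 j) 0 1%:M.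
have EE : E (-1) *m E 1 = 1%:M.
  rewrite mulmx_block !mulmx0 !mul0mx !mulmx1 !mul1mx !addr0 add0r.
  by rewrite scaleN1r scale1r subrr -scalar_mx_block.
have detE s : \det (E s) = 1 by rewrite det_ublock !det1 mulr1.
have M1_00 : (E 1 *m M) 0 0 = M (rshift 1 j : 'I_(1 + n)) 0.
  have z : 0 = lshift n 0 :> 'I_(1 + n) by apply: val_inj.
  rewrite mxE (@big_split_ord _ _ _ 1 n) /= big_ord1 -z a0 mulr0 add0r.
  rewrite (bigD1 j) //= big1 ?addr0 => [|i ij].
    by rewrite {1}z /E block_mxEur !mxE !eqxx mulr1 mul1r.
  by rewrite {1}z /E block_mxEur !mxE eqxx (negbTE ij) mulr0 mul0r.
have uEM : E 1 *m M \in unitmx by rewrite unitmxE det_mulmx detE mul1r -unitmxE.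
have IH1 v : scales (fun r : 'rV[R]_n => r *m 1%:M + v) 1.
  by have := IH 1%:M v (unitmx1 _ _); rewrite det1 normr1 invr1.
have := scales_comp (scales_rest (- delta_mx 0 j) 0 ler01 IH1)
  (scales_pivot _ w uEM _).
rewrite M1_00 mul1r det_mulmx detE mul1r => /(_ Mj).
congr scales; apply/funext=> x /=; rewrite row_mx0 addr0; congr (_ + _).
by rewrite mulmxA -[x *m _ *m E 1]mulmxA -scaleN1r EE mulmx1.
Qed.

End AffineChange.

(** * The volume of the corner simplex *)

Section Corner.
Context (R : realType).
Local Notation mR := (measurableTypeR R).
Local Notation mu := (@lebesgue_measure R).

(** The convex hull of 0 and the multiples by [s] of the unit vectors. *)
Definition corner n (s : R) : set 'rV[R]_n :=
  [set r | (forall i, 0 <= r 0 i) /\ \sum_i r 0 i <= s].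

Lemma row_measurable_corner n s : row_measurable (@corner n s).
Proof.
have rE (t : n.-tuple mR) i : tuple_row t 0 i = tnth t i by rewrite mxE.
have sE (t : n.-tuple mR) : \sum_i tuple_row t 0 i = \sum_i tnth t i.
  by apply: eq_bigr => i _; rewrite rE.
have cornerE : @tuple_row R n @^-1` corner s =
    \bigcap_(i in [set: 'I_n]) ((@tnth n mR ^~ i) @^-1` `[0, +oo[%classic) `&`
    ((fun t : n.-tuple mR => \sum_i tnth t i : mR) @^-1` `]-oo, s]%classic).
  apply/seteqP; split=> t /=; rewrite /corner /= sE in_itv /= => -[t0 ts]; split=> //.
    by move=> i _; rewrite /= in_itv /= andbT -rE.
  by move=> i; have := t0 i I; rewrite /= in_itv /= andbT rE.
rewrite /row_measurable cornerE; apply: measurableI.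
  apply: fin_bigcap_measurable => [|i _]; first exact: finite_finset.
  rewrite -[X in measurable X]setTI.
  exact: (measurable_tnth i).
rewrite -[X in measurable X]setTI.
apply: (measurable_sum _ (fun i => @measurable_tnth _ mR n i)) => //.
Qed.

Lemma horner_continuous (p : {poly R}) : continuous (fun x : R => p.[x]).
Proof.
move=> x; apply: differentiable_continuous; apply/derivable1_diffP.
by have [] := is_derive_poly p x.
Qed.

Lemma integral_power n (s : R) : 0 <= s ->
  (\int[mu]_(x in `[0%R, s]) ((s - x) ^+ n / n`!%:R)%R%:E =
    (s ^+ n.+1 / n.+1`!%:R)%R%:E)%E.
Proof.
rewrite le_eqVlt => /predU1P[<-|s0].
  by rewrite set_itv1 integral_set1 expr0n mul0r.
pose p : {poly R} := n`!%:R^-1 *: (s%:P - 'X) ^+ n.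
pose q : {poly R} := - (n.+1`!%:R^-1 *: (s%:P - 'X) ^+ n.+1).
have qp : q^`() = p.
  rewrite derivN derivZ deriv_exp derivB derivC derivX sub0r mulN1r.
  rewrite mulNrn scalerN opprK -[_ ^+ _ *+ _]scaler_nat scalerA.
  congr (_ *: _); rewrite factS natrM invfM /= mulrAC mulVf ?mul1r //.
have pE x : p.[x] = (s - x) ^+ n / n`!%:R.
  by rewrite hornerZ horner_exp !hornerE mulrC.
have qE x : q.[x] = - ((s - x) ^+ n.+1 / n.+1`!%:R).
  by rewrite hornerN hornerZ horner_exp !hornerE mulrC.
have ftc : (\int[mu]_(x in `[0%R, s]) (p.[x])%:E = (q.[s])%:E - (q.[0])%:E)%E.
  apply: (continuous_FTC2 (F := fun x => q.[x]) s0).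
  - apply: continuous_subspaceT => x; exact: horner_continuous.
  - split=> [x _| |].
    + by have [] := is_derive_poly q x.
    + by apply: cvg_at_right_filter; apply: horner_continuous.
    + by apply: cvg_at_left_filter; apply: horner_continuous.
  - by move=> x _; rewrite derive1E; have [_ ->] := is_derive_poly q x; rewrite qp.
transitivity (\int[mu]_(x in `[0%R, s]) (p.[x])%:E)%E.
  by apply: eq_integral => x _; rewrite pE.
by rewrite ftc !qE subrr subr0 expr0n mul0r oppr0 -EFinB sub0r opprK.
Qed.

(** The slice of the corner of size [s] at [x] is the corner of size [s - x],
    so the volumes satisfy the recursion of [integral_power]. *)
Lemma Vol_corner n (s : R) : 0 <= s -> Vol (@corner n s) = (s ^+ n / n`!%:R)%:E.
Proof.
elim: n s => [|n IH] s s0.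
  rewrite expr0 divr1 /Vol /= diracE mem_set //=.
  by split=> [[]//|]; rewrite big_ord0.
rewrite [LHS]Vol_slice -integral_power // [RHS]integral_mkcond.
apply: eq_integral => x _; rewrite patchE.
have sum_cons (r : 'rV[R]_n) :
    \sum_i (row_mx x%:M r : 'rV[R]_(1 + n)) 0 i = x + \sum_i r 0 i.
  rewrite (@big_split_ord _ _ _ 1 n) /= big_ord1 row_mxEl mxE mulr1n; congr (_ + _).
  by apply: eq_bigr => i _; rewrite row_mxEr.
have restE (r : 'rV[R]_n) i : (row_mx x%:M r : 'rV[R]_(1 + n)) 0 (rshift 1 i) = r 0 i.
  by rewrite row_mxEr.
have headE (r : 'rV[R]_n) : (row_mx x%:M r : 'rV[R]_(1 + n)) 0 (lshift n 0) = x.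
  by rewrite row_mxEl mxE mulr1n.
have Vol0 (A : set 'rV[R]_n) : A = set0 -> Vol A = 0%E.
  by move=> ->; have [m mE] := lebesgue_tuple_measure R n; rewrite /Vol -mE measure0.
case: ifPn => [|]; rewrite ?notin_setE ?inE /= in_itv /=.
  move=> /andP[x0 xs]; rewrite -IH ?subr_ge0 //; congr (Vol _).
  apply/seteqP; split=> r; rewrite /slice /corner /= sum_cons -lerBrDl => -[r0 rs].
    by split=> // i; rewrite -restE; exact: r0.
  split=> // i; case: (@splitP 1 n i) => j ij.
    by rewrite (_ : i = @lshift 1 n 0) ?headE //; apply: val_inj; rewrite /= ij [j]ord1.
  by rewrite (_ : i = rshift 1 j) ?restE //; apply: val_inj.
move=> xs; apply: Vol0; rewrite -subset0 => r; rewrite /slice /corner /= sum_cons.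
move=> [r0 rs]; apply: xs; apply/andP; split.
  by rewrite -(headE r); exact: r0.
apply: le_trans rs; rewrite lerDl sumr_ge0 // => i _.
by rewrite -restE; exact: r0.
Qed.

End Corner.

(** * Barycentric coordinates and the convex hull *)

Section Barycentric.
Context (R : realType) (d : nat) (v : 'I_d.+1 -> 'rV[R]_d).
Context (free_v : affinely_independent v).

Definition homogenize (p : 'rV[R]_d) : 'rV[R]_(1 + d) := row_mx 1%:M p.

(** The rows are the vertices in homogeneous coordinates, so barycentric
    coordinates are obtained by inverting this matrix. *)
Definition hull_mx : 'M[R]_d.+1 :=
  row_mx (const_mx 1 : 'cV[R]_d.+1) (\matrix_i v i) : 'M[R]_(d.+1, 1 + d).

Definition combine (w : 'rV[R]_d.+1) : 'rV[R]_d := \sum_i w 0 i *: v i.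

Lemma mul_hull_mx w : w *m hull_mx = row_mx (mass w)%:M (combine w) :> 'rV[R]_(1 + d).
Proof.
etransitivity; first exact: (mul_mx_row w (const_mx 1) (\matrix_i v i)).
congr row_mx.
  apply/rowP=> i; rewrite [i]ord1 !mxE mulr1n; apply: eq_bigr => j _.
  by rewrite mxE mulr1.
by rewrite mulmx_sum_row; apply: eq_bigr => i _; rewrite rowK.
Qed.

Lemma hull_mx_unit : hull_mx \in unitmx.
Proof.
rewrite -row_free_unit -kermx_eq0; apply/eqP/row_matrixP=> i; rewrite row0.
set w := row i _.
have : w *m hull_mx = 0 by rewrite -row_mul mulmx_ker row0.
rewrite mul_hull_mx => wH0.
have [m0 c0] : (mass w)%:M = 0 :> 'M[R]_1 /\ combine w = 0.
  by apply: eq_row_mx; rewrite row_mx0; exact: wH0.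
apply/rowP=> j; rewrite [RHS]mxE; apply: (free_v (w := fun j => w 0 j)) => //.
by move/matrixP/(_ 0 0): m0; rewrite !mxE mulr1n.
Qed.

Definition bary (p : 'rV[R]_d) : 'rV[R]_d.+1 := (homogenize p : 'rV[R]_d.+1) *m invmx hull_mx.

Lemma bary_unique w p : mass w = 1 -> combine w = p -> bary p = w.
Proof.
by move=> w1 <-; rewrite /bary /homogenize -w1 -mul_hull_mx mulmxK // hull_mx_unit.
Qed.

Lemma baryP p : mass (bary p) = 1 /\ combine (bary p) = p.
Proof.
have : bary p *m hull_mx = homogenize p by rewrite mulmxKV // hull_mx_unit.
rewrite mul_hull_mx => homogE.
have [m1 ->] : (mass (bary p))%:M = 1%:M :> 'M[R]_1 /\ combine (bary p) = p.
  by apply: eq_row_mx; exact: homogE.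
split=> //.
by move/matrixP/(_ 0 0): m1; rewrite !mxE !mulr1n.
Qed.

Lemma mass_delta i : mass (delta_mx 0 i : 'rV[R]_d.+1) = 1.
Proof.
rewrite /mass (bigD1 i) //= big1 ?addr0 => [|j ji]; first by rewrite mxE !eqxx.
by rewrite mxE (negbTE ji) andbF.
Qed.

Lemma combine_delta i : combine (delta_mx 0 i) = v i.
Proof.
rewrite /combine (bigD1 i) //= big1 ?addr0 => [|j ji]; rewrite !mxE !eqxx ?scale1r //.
by rewrite (negbTE ji) scale0r.
Qed.

Lemma combine_lin a w b z : combine (a *: w + b *: z) = a *: combine w + b *: combine z.
Proof.
rewrite /combine !scaler_sumr -big_split; apply: eq_bigr => i _ /=.
by rewrite !mxE scalerDl !scalerA.
Qed.

Lemma bary_affine a p b q :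
  a + b = 1 -> bary (a *: p + b *: q) = a *: bary p + b *: bary q.
Proof.
move=> ab; have [mp cp] := baryP p; have [mq cq] := baryP q.
apply: bary_unique; first by rewrite massD !massZ mp mq !mulr1.
by rewrite combine_lin cp cq.
Qed.

Lemma bary_affineE a p b q i :
  a + b = 1 -> bary (a *: p + b *: q) 0 i = a * bary p 0 i + b * bary q 0 i.
Proof. by move=> ab; rewrite bary_affine // mxE; congr (_ + _); rewrite mxE. Qed.

Lemma bary_vertex i : bary (v i) = delta_mx 0 i.
Proof. by apply: bary_unique; [exact: mass_delta|exact: combine_delta]. Qed.

Lemma bary_inj : injective bary.
Proof. by move=> p q pq; rewrite -(proj2 (baryP p)) pq (proj2 (baryP q)). Qed.

Lemma convex_setP (A : set 'rV[R]_d) : @convex_set R 'rV[R]_d A <->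
  (forall x y (t : R), A x -> A y -> 0 <= t <= 1 -> A (t *: x + (1 - t) *: y)).
Proof.
split=> cA.
  move=> x y t Ax Ay /andP[t0 t1]; have := cA x y (Itv01 t0 t1).
  by rewrite !inE => /(_ Ax Ay).
move=> x y l; rewrite !inE => Ax Ay; apply: (cA x y l%:num) => //.
by apply/andP; split; [exact: ge0|exact: le1].
Qed.

(** Partial sums of a convex combination, divided by their total weight, stay
    in [A]; the last one is the combination itself. *)
Lemma convex_combine (A : set 'rV[R]_d) (w : 'rV[R]_d.+1) :
  @convex_set R 'rV[R]_d A -> (forall i, A (v i)) ->
  (forall i, 0 <= w 0 i) -> mass w = 1 -> A (combine w).
Proof.
move=> /convex_setP cA Av w0 w1.
suff gen (s : seq 'I_d.+1) : 0 < \sum_(i <- s) w 0 i ->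
    A ((\sum_(i <- s) w 0 i)^-1 *: \sum_(i <- s) w 0 i *: v i).
  have := gen (index_enum _); rewrite -/(mass w) w1 invr1 scale1r; apply.
  exact: ltr01.
elim: s => [|i s IH]; first by rewrite big_nil ltxx.
rewrite !big_cons; set W := \sum_(i <- s) w 0 i; set V := \sum_(i <- s) _ *: _.
have W0 : 0 <= W by apply: sumr_ge0.
have [Wz|Wn] := eqVneq W 0.
  have -> : V = 0.
    rewrite /V big1_seq // => j /andP[_ js]; apply/eqP; rewrite scaler_eq0.
    move/eqP: Wz; rewrite psumr_eq0 // => /allP/(_ j js) /= ->; exact: isT.
  by rewrite Wz !addr0 => wi; rewrite scalerA mulVf ?scale1r ?gt_eqF.
have {}W0 : 0 < W by rewrite lt_neqAle eq_sym Wn.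
move=> wW; have {}IH := IH W0.
have -> : (w 0 i + W)^-1 *: (w 0 i *: v i + V) =
    (w 0 i / (w 0 i + W)) *: v i + (1 - w 0 i / (w 0 i + W)) *: (W^-1 *: V).
  rewrite scalerDr !scalerA [_^-1 * w 0 i]mulrC; congr (_ + _ *: _).
  by field; rewrite !gt_eqF.
apply: cA => //; rewrite divr_ge0 ?w0 ?(ltW wW) //=.
by rewrite ler_pdivrMr // mul1r lerDl ltW.
Qed.

Let T := convex_hull (range v).

(** The points with nonnegative coordinates form a convex set containing the
    vertices, and each of them is a convex combination of the vertices. *)
Lemma hullE p : T p <-> forall i, 0 <= bary p 0 i.
Proof.
split.
  move=> Tp; apply: (Tp [set p | forall i, 0 <= bary p 0 i]); split.
    apply/convex_setP => x y t x0 y0 /andP[t0 t1] i /=.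
    rewrite bary_affineE; last by rewrite addrC subrK.
    by apply: addr_ge0; rewrite mulr_ge0 ?subr_ge0.
  by move=> _ [i _ <-] j /=; rewrite bary_vertex mxE ler0n.
move=> p0 A [cA vA]; rewrite -(proj2 (baryP p)); apply: convex_combine => //.
  by move=> i; apply: vA; exists i.
exact: (proj1 (baryP p)).
Qed.

Lemma vertex_mem i : vertices T (v i).
Proof.
split; first by apply/hullE=> j; rewrite bary_vertex mxE ler0n.
move=> y z t /hullE y0 /hullE z0 /andP[t0 t1] vyz.
have bE j : (j == i)%:R = t * bary y 0 j + (1 - t) * bary z 0 j.
  rewrite -bary_affineE; last by rewrite addrC subrK.
  by rewrite -vyz bary_vertex mxE eqxx.
suff eqd x : (forall j, j != i -> bary x 0 j = 0) -> x = v i.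
  have yz0 j : j != i -> bary y 0 j = 0 /\ bary z 0 j = 0.
    move=> ji; have := bE j; rewrite (negbTE ji) => /esym/eqP.
    rewrite paddr_eq0 ?mulr_ge0 ?subr_ge0 ?y0 ?z0 ?(ltW t0) ?(ltW t1) //.
    rewrite !mulf_eq0 subr_eq0 (gt_eqF t0) (gt_eqF t1) /= => /andP[/eqP -> /eqP ->].
    by [].
  by split; apply: eqd => // j /yz0[].
move=> xz; apply: bary_inj; rewrite bary_vertex; apply/rowP=> j.
have [m1 _] := baryP x.
have [->|ji] := eqVneq j i; last by rewrite xz // [RHS]mxE (negbTE ji) andbF.
by rewrite [RHS]mxE !eqxx -[RHS]m1 /mass (bigD1 i) //= big1 ?addr0.
Qed.

(** If the [i]-th coordinate of [p] vanished, moving from [p] straight away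
    from vertex [i] would make it negative at once. *)
Lemma interior_bary p i : interior T p -> 0 < bary p 0 i.
Proof.
move=> /nbhs_ballP[e /= e0 eT].
have Tp : T p by apply: eT; exact: ballxx.
have p0 := (hullE p).1 Tp.
rewrite lt_neqAle p0 andbT eq_sym; apply/eqP=> pi.
pose S := \sum_j `|(p - v i) 0 j|.
have S0 : 0 <= S by apply: sumr_ge0.
(* Moving by t (p - v i) changes each entry by less than e; the added 1
   guards against a zero denominator. *)
pose t := e / (S + 1).
have t0 : 0 < t by rewrite divr_gt0 // ltr_wpDl.
have : T ((1 + t) *: p + (- t) *: v i).
  apply: eT; split=> // k j; rewrite [k]ord1.
  rewrite /ball /= (_ : _ - _ = - t * (p - v i) 0 j); last by rewrite !mxE; ring.
  rewrite normrM normrN (gtr0_norm t0) /t mulrAC ltr_pdivrMr ?ltr_wpDl // ltr_pM2l //.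
  apply: (@le_lt_trans _ _ S); last by rewrite ltrDl.
  by rewrite /S (bigD1 j) //= lerDl sumr_ge0.
move/hullE/(_ i); rewrite bary_affineE ?addrK // bary_vertex pi mxE !eqxx.
by rewrite mulr0 add0r mulr1 oppr_ge0 leNgt t0.
Qed.

End Barycentric.

(** * The volume of a simplex *)

Section HullVolume.
Context (R : realType) (d : nat) (v : 'I_d.+1 -> 'rV[R]_d).
Context (free_v : affinely_independent v).

Let edges : 'M[R]_d := \matrix_i (v (lift ord0 i) - v ord0).

(** Subtracting the first row from the others. *)
Lemma det_hull_mx : \det (hull_mx v) = \det edges.
Proof.
have E : hull_mx v = (block_mx 1%:M 0 (const_mx 1) 1%:M : 'M[R]_(1 + d)) *m
    (block_mx 1%:M (v ord0) 0 edges : 'M[R]_(1 + d)).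
  rewrite mulmx_block !mulmx0 !mul0mx !mul1mx !mulmx1 !addr0.
  have hullL i (l : 'I_1) : hull_mx v i (@lshift 1 d l) = 1.
    by etransitivity; [exact: (@row_mxEl R d.+1 1 d)|rewrite mxE].
  have hullR i l : hull_mx v i (@rshift 1 d l) = v i 0 l.
    by etransitivity; [exact: (@row_mxEr R d.+1 1 d)|rewrite mxE].
  apply/matrixP=> i j.
  case: (@splitP 1 d j) => l jl.
    have {jl}-> : j = lshift d l by apply: val_inj.
    rewrite hullL; case: (@splitP 1 d i) => k ik.
      rewrite (_ : i = lshift d k); last exact: val_inj.
      by rewrite [RHS](@block_mxEul R 1 d 1 d) [k]ord1 [l]ord1 mxE mulr1n.
    rewrite (_ : i = rshift 1 k); last exact: val_inj.
    by rewrite [RHS](@block_mxEdl R 1 d 1 d) mxE.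
  have {jl}-> : j = rshift 1 l by apply: val_inj.
  rewrite hullR; case: (@splitP 1 d i) => k ik.
    rewrite (_ : i = lshift d k); last exact: val_inj.
    rewrite [RHS](@block_mxEur R 1 d 1 d) [k]ord1.
    by congr (fun_of_matrix (v _) _ _); apply: val_inj.
  rewrite (_ : i = rshift 1 k); last exact: val_inj.
  rewrite [RHS](@block_mxEdr R 1 d 1 d) !mxE big_ord1 mxE mul1r addrC subrK.
  by congr (fun_of_matrix (v _) _ _); apply: val_inj.
rewrite E det_mulmx -[RHS]mul1r; congr (_ * _).
  by etransitivity; [exact: (@det_lblock R 1 d)|rewrite !det1 mulr1].
by etransitivity; [exact: (@det_ublock R 1 d)|rewrite det1 mul1r].
Qed.

Lemma edges_unit : edges \in unitmx.
Proof. by rewrite unitmxE -det_hull_mx -unitmxE hull_mx_unit. Qed.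

(** The last [d] barycentric coordinates of [p] are the coordinates of
    [p - v ord0] in the basis of edges at [v ord0]. *)
Lemma hull_corner p :
  convex_hull (range v) p <-> corner 1 ((p - v ord0) *m invmx edges).
Proof.
set r := (p - v ord0) *m invmx edges.
(* The first barycentric coordinate is what the others lack to 1. *)
pose c : 'rV[R]_d.+1 := (row_mx (1 - \sum_i r 0 i)%:M r : 'rV[R]_(1 + d)).
have c0 : c 0 ord0 = 1 - \sum_i r 0 i.
  have -> : ord0 = @lshift 1 d 0 by apply: val_inj.
  by rewrite [LHS](@row_mxEl R 1 1 d) mxE mulr1n.
have cS i : c 0 (lift ord0 i) = r 0 i.
  have -> : lift ord0 i = @rshift 1 d i by apply: val_inj.
  by rewrite [LHS](@row_mxEr R 1 1 d).
have cE : bary v p = c.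
  apply: bary_unique => //.
    have sr : \sum_(i < d) c 0 (lift ord0 i) = \sum_i r 0 i.
      by apply: eq_bigr => i _; rewrite cS.
    by rewrite /mass big_ord_recl c0 sr subrK.
  have sr : \sum_(i < d) c 0 (lift ord0 i) *: v (lift ord0 i) =
      \sum_i r 0 i *: v (lift ord0 i).
    by apply: eq_bigr => i _; rewrite cS.
  rewrite /combine big_ord_recl c0 sr.
  have : r *m edges = p - v ord0 by rewrite mulmxKV // edges_unit.
  rewrite mulmx_sum_row; under eq_bigr do rewrite rowK scalerBr.
  rewrite sumrB -scaler_suml => E.
  by rewrite scalerBl scale1r addrAC -addrA E addrC subrK.
rewrite hullE // cE; split=> [c_ge0|[r0 r1] i].
  split=> [i|]; first by rewrite -cS.
  by rewrite -subr_ge0 -c0.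
by case: (unliftP ord0 i) => [j ->|->]; rewrite ?cS ?c0 ?subr_ge0.
Qed.

Lemma Vol_hull :
  Vol (convex_hull (range v)) = (`|\det (hull_mx v)| / d`!%:R)%:E.
Proof.
have -> : convex_hull (range v) =
    (fun x => x *m invmx edges + - (v ord0 *m invmx edges)) @^-1` corner 1.
  by apply/seteqP; split=> p /=; rewrite hull_corner mulmxBl.
have uE : invmx edges \in unitmx by rewrite unitmx_inv edges_unit.
have [_ ->] := scales_affine (- (v ord0 *m invmx edges)) uE
  (@row_measurable_corner R d 1).
rewrite Vol_corner // expr1n -EFinM det_inv normfV invrK det_hull_mx.
by rewrite mul1r.
Qed.

End HullVolume.

(** * Lattice points of a lattice simplex *)

Lemma det_int (R : archiNumDomainType) n (A : 'M[R]_n) :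
  (forall i j, A i j \is a Num.int) -> \det A \is a Num.int.
Proof.
move=> AZ; apply: rpred_sum => s _; apply: rpredM; last exact: rpred_prod.
by rewrite rpredX // rpredN rpred1.
Qed.

Section LatticeCoordinates.
Context (R : realType) (d : nat) (v : 'I_d.+1 -> 'rV[R]_d).
Context (free_v : affinely_independent v).
Context (lattice_v : forall i, lattice (v i)).

Definition bary_lattice (w : 'rV[R]_d.+1) : Prop :=
  mass w = 1 /\ lattice (combine v w).

(** The product [W *m hull_mx v] has rows [(1, p)] with [p] a lattice point, so
    its determinant is an integer. *)
Lemma bary_latticeP : barycentric_lattice `|\det (hull_mx v)| bary_lattice.
Proof.
split=> [w []//|i|W latW].
  by split; [exact: mass_delta|rewrite combine_delta].
have : \det (W *m hull_mx v) \is a Num.int.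
  apply: det_int => i j.
  have -> : (W *m hull_mx v) i j = (row i (W *m hull_mx v)) 0 j by rewrite [RHS]mxE.
  rewrite row_mul mul_hull_mx; have [m1 cZ] := latW i.
  case: (@splitP 1 d j) => l jl.
    have -> : j = @lshift 1 d l by apply: val_inj.
    by rewrite (@row_mxEl R 1 1 d) m1 [l]ord1 mxE mulr1n rpred1.
  have -> : j = @rshift 1 d l by apply: val_inj.
  by rewrite (@row_mxEr R 1 1 d); exact: cZ.
rewrite det_mulmx mulrC; have [|] := ger0P (\det (hull_mx v)) => // _.
by rewrite mulNr rpredN.
Qed.

End LatticeCoordinates.

(** * Collinearity of the interior lattice points with a vertex *)

Theorem corollary6p2 (R : realType) (d k : nat) (T : set 'rV[R]_d) :
  (3 <= d)%N ->
  T \in clean_lattice_simplices R d k ->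
  Vol T = ((d`!%:R)^-1 * (d * k + 1)%:R)%:E ->
  exists (v : 'rV[R]_d) (L : set 'rV[R]_d),
    [/\ v \in vertices T, line L &
        (interior T `&` lattice) `|` [set v] `<=` L].
Proof.
move=> d3; rewrite inE => -[[[v free_v TE] Tlat] _ cardP] VolT.
have vT i : vertices T (v i) by rewrite TE; apply: vertex_mem.
have lattice_v i : lattice (v i) by apply: Tlat.
have detE : `|\det (hull_mx v)| = (d * k).+1%:R.
  move: VolT; rewrite TE Vol_hull // => -[].
  rewrite mulrC => /mulfI; rewrite addn1; apply.
  by rewrite invr_eq0 pnatr_eq0 -lt0n fact_gt0.
set P := interior T `&` lattice in cardP *.
have finP : finite_set P by exists k.
pose ps : seq 'rV[R]_d := fset_set P.
have memP p : p \in ps -> P p by rewrite in_fset_set // inE.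
have memP' p : P p -> p \in ps by move=> Pp; rewrite in_fset_set // inE.
have sizeP : size ps = k by rewrite -(card_fset_set cardP).
pose xs := map (bary v) ps.
have tight : tight_configuration (bary_lattice v) xs.
  split.
  - by rewrite size_map sizeP /= -detE; apply: bary_latticeP.
  - by rewrite map_inj_uniq ?fset_uniq //; apply: bary_inj.
  - move=> _ /mapP[p /memP[_ pZ] ->].
    by have [m1 c1] := baryP free_v p; split; rewrite ?c1.
  - move=> _ /mapP[p /memP[pT _] ->] i.
    by apply: interior_bary; rewrite // -TE.
(* Without interior points any line through a vertex will do. *)
have [k0|k0] := posnP k.
  have P0 : P = set0.
    by rewrite -subset0 => p /memP'; rewrite (size0nil (etrans sizeP k0)).
  exists (v ord0), [set v ord0 + t *: const_mx 1 | t in [set: R]]; split.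
  - by rewrite inE; apply: vT.
  - exists (v ord0), (const_mx 1); split=> //.
    apply/eqP => /rowP/(_ (Ordinal (leq_trans (isT : 0 < 3)%N d3)))/eqP.
    by rewrite !mxE oner_eq0.
  - rewrite P0 set0U => _ ->; exists 0 => //; by rewrite scale0r addr0.
have s0 : (0 < size xs)%N by rewrite size_map sizeP.
have [x [l [xxs xl]]] := @tight_collinear R d.+1 _ xs d3 tight s0.
have [p0 p0s xE] := mapP xxs.
exists (v l), [set v l + t *: (p0 - v l) | t in [set: R]]; split.
- by rewrite inE; apply: vT.
- exists (v l), (p0 - v l); split=> //; rewrite subr_eq0.
  apply/eqP=> p0E; have [j jl] : exists j : 'I_d.+1, j != l.
    exists (lift l (Ordinal (leq_trans (isT : 0 < 3)%N d3))).
    by rewrite eq_sym neq_lift.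
  have := tight_pos tight xxs j.
  by rewrite xE p0E bary_vertex // mxE (negbTE jl) andbF ltxx.
move=> p [Pp|->]; last by exists 0 => //; rewrite scale0r addr0.
have pxs : bary v p \in xs by apply: map_f; apply: memP'.
have [t pt] := xl _ pxs; exists t => //.
have -> : v l + t *: (p0 - v l) = t *: p0 + (1 - t) *: v l.
  by rewrite scalerBr scalerBl scale1r addrCA.
have t1 : t + (1 - t) = 1 by rewrite addrC subrK.
apply: (bary_inj free_v); apply: esym.
(* The coordinates agree off l, and the one at l is determined by the mass. *)
have offl m : m != l -> bary v p 0 m = (t *: bary v p0 + (1 - t) *: delta_mx 0 l) 0 m.
  by move=> ml; rewrite pt // xE !mxE (negbTE ml) andbF mulr0 addr0.
have sumE (w : 'rV[R]_d.+1) : mass w = 1 -> w 0 l = 1 - \sum_(m | m != l) w 0 m.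
  by move=> <-; rewrite /mass [X in _ = X - _](bigD1 l) //= addrK.
rewrite bary_affine // bary_vertex //; apply/rowP=> m.
have [->|/offl //] := eqVneq m l.
have mass_w : mass (t *: bary v p0 + (1 - t) *: delta_mx 0 l) = 1.
  by rewrite massD !massZ mass_delta (baryP free_v p0).1 !mulr1.
rewrite (sumE _ (baryP free_v p).1) (sumE _ mass_w).
by congr (_ - _); apply: eq_bigr => j /offl.
Qed.
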